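(* Let $\vartheta_1,\vartheta_2\in\mathbb{R}$, let $\sigma\in(0,\infty)$, let $(Z_n)_{n\in\mathbb{N}}$ be a sequence of i.i.d. random variables with $Z_1\sim\mathcal{N}(0,\sigma^2)$, and let $(X_0,X_{-1})^\top$ be an $\mathbb{R}^2$-valued random vector independent of $(Z_n)_{n\in\mathbb{N}}$ with $\mathbb{E}(X_0^2)<\infty$ and $\mathbb{E}(X_{-1}^2)<\infty$. Let $(X_k)_{k\geq -1}$ be the AR(2) process defined by $X_n=\vartheta_1X_{n-1}+\vartheta_2X_{n-2}+Z_n$, $n\in\mathbb{N}$. Suppose that the characteristic polynomial $x^2-\vartheta_1x-\vartheta_2$ has real roots $\lambda_1$ and $\lambda_2$ with $|\lambda_1|>|\lambda_2|$ and $|\lambda_1|>1$. Let $(\widehat\vartheta_1^{(n)},\widehat\vartheta_2^{(n)})^\top$ denote the least squares estimator of $(\vartheta_1,\vartheta_2)^\top$ based on $X_{-1},X_0,X_1,\ldots,X_n$. Then $$ \begin{bmatrix} \left(\sum_{k=1}^n X_{k-1}^2\right)^{1/2} & \dfrac{\sum_{k=1}^n X_{k-1}X_{k-2}}{\left(\sum_{k=1}^n X_{k-1}^2\right)^{1/2}}\\[3mm] \dfrac{\sum_{k=1}^n X_{k-1}X_{k-2}}{\left(\sum_{k=1}^n X_{k-2}^2\right)^{1/2}} & \left(\sum_{k=1}^n X_{k-2}^2\right)^{1/2} \end{bmatrix} \begin{bmatrix}\widehat\vartheta_1^{(n)}-\vartheta_1\\ \widehat\vartheta_2^{(n)}-\vartheta_2\end{bmatrix}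 \to \sigma N\begin{bmatrix}1\\ \operatorname{sign}(\lambda_1)\end{bmatrix} \qquad \mathcal{F}_\infty\text{-mixing as } n\to\infty, $$ where $N$ is a standard normally distributed random variable that is $\mathbb{P}$-independent of $\mathcal{F}_\infty$.
   Context: All random variables are defined on a suitable probability space $(\Omega,\mathcal{F},\mathbb{P})$. Put $\mathcal{F}_n:=\sigma(X_{-1},X_0,X_1,\ldots,X_n)$ for $n\in\{0,1,2,\ldots\}$ and $\mathcal{F}_\infty:=\sigma(\bigcup_{n=0}^\infty\mathcal{F}_n)\subset\mathcal{F}$. It is a standing assumption that the probability space $(\Omega,\mathcal{F}_\infty,\mathbb{P})$ is complete, i.e., every subset of a $\mathbb{P}$-null set belonging to $\mathcal{F}_\infty$ belongs to $\mathcal{F}_\infty$. Least squares estimator (LSE): a measurable function of $(X_{-1},X_0,\ldots,X_n)$ that minimizes $\sum_{k=1}^n(X_k-\vartheta_1X_{k-1}-\vartheta_2X_{k-2})^2$ over $(\vartheta_1,\vartheta_2)^\top\in\mathbb{R}^2$. For each $n\ge 3$ the event $\Omega_n:=\left\{\det\left(\sum_{k=1}^n\begin{bmatrix}X_{k-1}\\ X_{k-2}\end{bmatrix}\begin{bmatrix}X_{k-1}\\ X_{k-2}\end{bmatrix}^\top\right)>0\right\}$ has probability 1, and on $\Omega_n$ the LSE is unique and given by $$\begin{bmatrix}\widehat\vartheta_1^{(n)}\\ \widehat\vartheta_2^{(n)}\end{bmatrix}=\left(\sum_{k=1}^n\begin{bmatrix}X_{k-1}\\ X_{k-2}\end{bmatrix}\begin{bmatrix}X_{k-1}\\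 X_{k-2}\end{bmatrix}^\top\right)^{-1}\sum_{k=1}^nX_k\begin{bmatrix}X_{k-1}\\ X_{k-2}\end{bmatrix}.$$ The scaling matrix in the claim is well-defined with probability 1 for each $n\geq 3$. Mixing convergence: let $\mathcal{G}\subset\mathcal{F}$ be a sub-$\sigma$-field and let $\boldsymbol{X}_n$ ($n\in\mathbb{N}$) and $\boldsymbol{X}$ be $\mathbb{R}^d$-valued random variables on $(\Omega,\mathcal{F},\mathbb{P})$. $\boldsymbol{X}_n$ converges $\mathcal{G}$-stably to $\boldsymbol{X}$ as $n\to\infty$ if $\lim_{n\to\infty}\mathbb{E}(\xi\,\mathbb{E}(h(\boldsymbol{X}_n)\mid\mathcal{G}))=\mathbb{E}(\xi\,\mathbb{E}(h(\boldsymbol{X})\mid\mathcal{G}))$ for all random variables $\xi:\Omega\to\mathbb{R}$ with $\mathbb{E}(|\xi|)<\infty$ and all bounded continuous $h:\mathbb{R}^d\to\mathbb{R}$. $\boldsymbol{X}_n$ converges $\mathcal{G}$-mixing to $\boldsymbol{X}$ if it converges $\mathcal{G}$-stably to $\boldsymbol{X}$ and $\sigma(\boldsymbol{X})$ and $\mathcal{G}$ are independent; equivalently, $\lim_{n\to\infty}\mathbb{E}(\xi\,\mathbb{E}(h(\boldsymbol{X}_n)\mid\mathcal{G}))=\mathbb{E}(\xi)\,\mathbb{E}(h(\boldsymbol{X}))$ for all such $\xi$ and $h$. *)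

(* Defs.v *)
From HB Require Import structures.
From mathcomp Require Import all_boot all_order all_algebra.
From mathcomp Require Import all_classical all_reals all_analysis.
From mathcomp Require Import measurable_realfun.

Set Implicit Arguments.
Unset Strict Implicit.
Unset Printing Implicit Defensive.

Import Order.TTheory GRing.Theory Num.Theory.
Import numFieldNormedType.Exports.

Local Open Scope classical_set_scope.
Local Open Scope ring_scope.

Section independence.
Context d (T : measurableType d) (R : realType) (P : probability T R).

Definition independent_sigma (F G : set (set T)) :=
  forall A B, F A -> G B -> P (A `&` B) = (P A * P B)%E.

Definition mutually_independent (Y : nat -> {RV P >-> R}) :=
  forall (s : seq nat) (B : nat -> set R), uniq s ->
    (forall k, measurable (B k)) ->
  P (\bigcap_(k in [set` s]) (Y k @^-1` B k)) =
  (\prod_(k <- s) P (Y k @^-1` B k))%E.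

(* Laws are compared on Borel sets only: off them both sides carry junk values. *)
Definition has_law (Y : {RV P >-> R}) (mu : set R -> \bar R) :=
  forall A, measurable A -> distribution P Y A = mu A.

Definition iid (Y : nat -> {RV P >-> R}) :=
  mutually_independent Y /\ forall k, has_law (Y k) (distribution P (Y 0%N)).

Definition sigma_seq (Y : nat -> {RV P >-> R}) : set (set T) :=
  <<s \bigcup_k preimage_set_system setT (Y k) measurable >>.

Definition complete_sub (G : set (set T)) :=
  forall A B, G A -> P A = 0%E -> B `<=` A -> G B.

End independence.

Section conditional_expectation.
Context d (T : measurableType d) (R : realType) (P : probability T R).
Implicit Types (G : set (set T)) (Y V : T -> R).

Definition is_condexp G Y V :=
  [/\ forall B, measurable B -> G (V @^-1` B),
      P.-integrable setT (EFin \o V) &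
      forall A, G A -> (\int[P]_(w in A) (V w)%:E = \int[P]_(w in A) (Y w)%:E)%E].

(* A chosen version; [condexpP] shows that one exists for every integrable Y. *)
Definition condexp G Y : T -> R := xget (cst 0) [set V | is_condexp G Y V].

Lemma condexpP G Y : sigma_algebra setT G -> G `<=` measurable ->
  P.-integrable setT (EFin \o Y) -> is_condexp G Y (condexp G Y).
Proof.
move=> sG GM iY.
suff [V HV] : exists V, is_condexp G Y V by exact: (xgetPex _ (ex_intro _ V HV)).
have mY : measurable_fun setT (EFin \o Y) by exact: measurable_int iY.
pose T' := g_sigma_algebraType G.
have GE A : measurable (A : set T') = G A.
  by rewrite /measurable/= sigma_algebra_id.
pose f : T -> T' := idfun.
have mf : measurable_fun setT f.
  by move=> _ B; rewrite GE setTI => /GM.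
pose F : {mfun T >-> T'} := HB.pack f (isMeasurableFun.Build _ _ _ _ f mf).
pose mu : probability T' R := distribution P F.
pose nuf : {charge set T' -> \bar R} := pushforward (induced_charge iY) f.
pose nu := nuf mf.
have numu : nu `<< mu.
  apply/null_content_dominatesP => A; rewrite GE => GA PA0.
  apply: null_set_integral => //; first exact: GM.
  exact: (measurable_funS measurableT (@subsetT T A) mY).
pose g : T' -> \bar R := Radon_Nikodym nu mu.
have mg : measurable_fun setT g.
  exact: measurable_int (Radon_Nikodym_integrable numu).
have gfin w : g w \is a fin_num by exact: Radon_Nikodym_fin_num.
have ig : P.-integrable setT (g \o f).
  apply/integrableP; split; first exact: measurableT_comp.
  have /integrableP[_] := Radon_Nikodym_integrable numu.
  rewrite ge0_integral_pushforward//.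
  exact: measurableT_comp.
exists (fine \o g); split.
- move=> B mB; rewrite -GE -[X in measurable X]setTI.
  by apply: measurableT_comp => //.
- apply: eq_integrable ig => // w _ /=; by rewrite fineK.
- move=> A GA; have mA : measurable (A : set T') by rewrite GE.
  transitivity (nu A) => //.
  rewrite (Radon_Nikodym_integral numu mA).
  rewrite integral_pushforward//.
    by apply: eq_integral => w _ /=; rewrite fineK.
  by apply: (integrableS measurableT) => //; exact: GM.
Qed.

End conditional_expectation.

Section mixing.
Context d (T : measurableType d) (R : realType) (P : probability T R).

(* R^m carries its product sigma-algebra, which is its Borel sigma-algebra. *)
Definition random_vector m (X : T -> 'cV[R]_m) :=
  forall i, measurable_fun setT (fun w => X w i 0).

Definition sigma_vector m (X : T -> 'cV[R]_m) : set (set T) :=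
  g_sigma_preimage (fun i w => X w i 0).

Definition stably_cvg (G : set (set T)) m (Xs : nat -> T -> 'cV[R]_m)
    (X : T -> 'cV[R]_m) :=
  [/\ forall n, random_vector (Xs n), random_vector X &
    forall (xi : {RV P >-> R}) (h : 'cV[R]_m -> R),
      ('E_P[fun w => `|xi w|%R] < +oo)%E ->
      continuous h -> (exists M : R, forall x, `|h x| <= M) ->
    'E_P[fun w => (xi w * condexp P G (h \o Xs n) w)%R]%E @[n --> \oo] -->
    'E_P[fun w => (xi w * condexp P G (h \o X) w)%R]%E].

Definition mixing_cvg (G : set (set T)) m (Xs : nat -> T -> 'cV[R]_m)
    (X : T -> 'cV[R]_m) :=
  stably_cvg G Xs X /\ independent_sigma P (sigma_vector X) G.

End mixing.

Definition cv2 (R : realType) (a b : R) : 'cV[R]_2 :=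
  \col_(i < 2) if i == 0 then a else b.

Definition mx22 (R : realType) (a b c d : R) : 'M[R]_2 :=
  \matrix_(i < 2, j < 2)
    if i == 0 then (if j == 0 then a else b) else (if j == 0 then c else d).

(* Index shift: the process (X_k)_{k >= -1} is stored as X : nat -> T -> R with
   X j standing for X_{j-1}, and the noise (Z_k)_{k >= 1} as Z with Z k standing
   for Z_{k+1}.  A sum over 1 <= k <= n becomes a sum over k < n, in which
   X k.+2, X k.+1, X k stand for X_k, X_{k-1}, X_{k-2}. *)
Section ar2.
Context d (T : measurableType d) (R : realType) (P : probability T R).
Implicit Types (X Z : nat -> {RV P >-> R}) (x : nat -> R) (n : nat).

Definition is_ar2 (th1 th2 : R) Z X :=
  forall k w, X k.+2 w = th1 * X k.+1 w + th2 * X k w + Z k w.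

Definition ar2_charpoly (th1 th2 : R) : {poly R} :=
  'X^2 - th1 *: 'X - th2%:P.

(* sigma(X_{-1}, X_0, ..., X_n) *)
Definition ar2_filtration X n : set (set T) :=
  g_sigma_preimage (fun (j : 'I_n.+2) => X j : T -> R).

Definition ar2_sigma_infty X : set (set T) :=
  <<s \bigcup_n ar2_filtration X n >>.

Definition ar2_rss n x (th : 'cV[R]_2) : R :=
  \sum_(k < n) (x k.+2 - th 0 0 * x k.+1 - th 1 0 * x k) ^+ 2.

Definition is_lse X n (est : T -> 'cV[R]_2) :=
  (exists2 f : n.+2.-tuple R -> 'cV[R]_2,
     forall i, measurable_fun setT (fun y => f y i 0) &
     forall w, est w = f [tuple X j w | j < n.+2]) /\
  forall w th, ar2_rss n (X ^~ w) (est w) <= ar2_rss n (X ^~ w) th.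

Definition lse_scaling n x : 'M[R]_2 :=
  let s11 := \sum_(k < n) x k.+1 ^+ 2 in
  let s12 := \sum_(k < n) x k.+1 * x k in
  let s22 := \sum_(k < n) x k ^+ 2 in
  mx22 (Num.sqrt s11)       (s12 / Num.sqrt s11)
       (s12 / Num.sqrt s22) (Num.sqrt s22).

End ar2.

(* Main.v *)
Require Import Defs.
From HB Require Import structures.
From mathcomp Require Import all_boot all_order all_algebra.
From mathcomp Require Import all_classical all_reals all_analysis.
From mathcomp Require Import measurable_realfun ring lra zify.
Import Order.TTheory GRing.Theory Num.Theory.
Import numFieldNormedType.Exports.
Local Open Scope classical_set_scope.
Local Open Scope ring_scope.

(** By the normal equations ([scaled_lse_error]) the scaled estimation error is
    always the pair of self-normalized sums
      [sum_k Z_k X_{k-1} / sqrt (sum_k X_{k-1} ^ 2)]  and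
      [sum_k Z_k X_{k-2} / sqrt (sum_k X_{k-2} ^ 2)],
    whether or not the design matrix is invertible.  Write [lam], [mu] for the two
    roots, [lam] being the dominant one.

    Pathwise part.  The process [X_n - mu X_{n-1}] is autoregressive of order one
    with explosive coefficient [lam]; divided by [lam ^ n] it converges to a
    random variable [y], and [lam ^- n X_n] converges to a multiple of [y] at a
    geometric rate.  The sums of squares are therefore dominated by their last
    terms, and both self-normalized sums are asymptotic, up to the sign of [y],
    to one and the same weighted sum of the innovations, with weights that decay
    geometrically backwards in time; passing from [X_{k-1}] to [X_{k-2}] only
    costs the sign of [lam].  All this holds on every path on which [y] is not
    zero and the innovations grow at most exponentially with a rate close to one
    ([ar2_self_normalized_cvg]).  Almost every path is of this kind: the first
    moment of the innovations bounds their growth ([noise_geo_bounded]), and [y]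
    does not vanish because one of its summands is a Gaussian variable that is
    independent of the others ([explosive_limit_neq0]).

    Distributional part.  Because of the decay of the weights, the weighted sum
    may be cut down to the last [n / 2] innovations and normalized to have exactly
    the law N(0, sigma^2) ([block_sum], [follows_normal_block_sum]).  The block
    sums of [n] and of [m >= 2 n] involve disjoint sets of innovations, so they
    are independent, and Bessel's inequality along a sparse subsequence shows
    that they decorrelate from every integrable variable [xi] whatsoever
    ([mixing_cvg_expectation]).  This makes it possible to condition on the sign
    of [y], although [y] depends on the whole future of the process: the
    expectation splits along that sign, and since the Gaussian law is symmetric
    both pieces have the same limit ([mixing_transfer]).

    Finally, the scaled error is a function of the observations and the limit is
    independent of them, so conditioning on the observations leaves the former
    unchanged and replaces the latter by a constant ([is_condexp_self],
    [is_condexp_cst]). *)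

Set Implicit Arguments.
Unset Strict Implicit.
Unset Printing Implicit Defensive.

(** * Geometric bounds *)

Definition geo_bounded (R : realType) (b : R) (u : nat -> R) : Prop :=
  exists2 C, 0 <= C & forall n, `|u n| <= C * b ^+ n.

Section geometric_bounds.
Context (R : realType).
Implicit Types (a b c r l : R) (u v f : nat -> R).

Lemma geo_boundedS a b u : 0 <= a <= b -> geo_bounded a u -> geo_bounded b u.
Proof.
move=> /andP[a0 ab] [C C0 uC]; exists C => // n.
by rewrite (le_trans (uC n))// ler_wpM2l// lerXn2r ?nnegrE// (le_trans a0).
Qed.

Lemma geo_boundedZ b c u : geo_bounded b u -> geo_bounded b (fun n => c * u n).
Proof.
move=> [C C0 uC]; exists (`|c| * C); first by rewrite mulr_ge0.
by move=> n; rewrite normrM -mulrA ler_wpM2l.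
Qed.

Lemma geo_boundedD b u v : geo_bounded b u -> geo_bounded b v ->
  geo_bounded b (fun n => u n + v n).
Proof.
move=> [C C0 uC] [D D0 vD]; exists (C + D); first exact: addr_ge0.
by move=> n; rewrite (le_trans (ler_normD _ _))// mulrDl lerD.
Qed.

Lemma geo_boundedM a b u v : geo_bounded a u -> geo_bounded b v ->
  geo_bounded (a * b) (fun n => u n * v n).
Proof.
move=> [C C0 uC] [D D0 vD]; exists (C * D); first exact: mulr_ge0.
by move=> n; rewrite normrM exprMn mulrACA ler_pM.
Qed.

(** A linear recursion whose ratio is smaller than the rate of its forcing term
    inherits the rate of the forcing term.  Below the ratio is [lam^-1],
    [lam^-2] or [mu / lam]. *)
Lemma geo_bounded_rec b r u f : `|r| < b -> geo_bounded b f ->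
  (forall n, u n.+1 = r * u n + f n) -> geo_bounded b u.
Proof.
move=> rb [C C0 fC] uE.
have b0 : 0 < b by rewrite (le_lt_trans _ rb).
have br0 : 0 < b - `|r| by rewrite subr_gt0.
have D0 : 0 <= C / (b - `|r|) by rewrite divr_ge0// ltW.
exists (`|u 0%N| + C / (b - `|r|)); first exact: addr_ge0.
elim=> [|n IH]; first by rewrite expr0 mulr1 lerDl.
rewrite uE (le_trans (ler_normD _ _))// normrM.
rewrite (le_trans (lerD (ler_wpM2l (normr_ge0 r) IH) (fC n)))//.
rewrite mulrA -mulrDl exprS mulrA ler_wpM2r ?exprn_ge0 ?(ltW b0)//.
set D := `|u 0%N| + _.
suff : C <= D * (b - `|r|) by nra.
by rewrite mulrDl divfK ?gt_eqF// lerDr mulr_ge0// ltW.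
Qed.

Lemma geo_bounded_cvg0 b u : 0 <= b < 1 -> geo_bounded b u -> u @ \oo --> 0.
Proof.
move=> /andP[b0 b1] [C C0 uC]; apply: norm_cvg0.
apply: (@squeeze_cvgr _ _ _ _ (cst 0) (geometric C b)).
- by apply: nearW => n /=; rewrite normr_ge0 uC.
- exact: cvg_cst.
- by apply: cvg_geometric; rewrite ger0_norm.
Qed.

(** The error at [n] is a tail of the series of increments, which a geometric
    tail dominates. *)
Lemma geo_bounded_cvg b u : 0 <= b < 1 ->
  geo_bounded b (fun n => u n.+1 - u n) ->
  exists2 l, u @ \oo --> l & geo_bounded b (fun n => u n - l).
Proof.
move=> /andP[b0 b1] [C C0 uC].
have b10 : 0 < 1 - b by rewrite subr_gt0.
have tail n k : `|u (n + k)%N - u n| <= C / (1 - b) * b ^+ n * (1 - b ^+ k).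
  elim: k => [|k IH]; first by rewrite addn0 subrr normr0 expr0 subrr mulr0.
  rewrite addnS -(subrK (u (n + k)%N) (u _.+1)) -addrA.
  rewrite (le_trans (ler_normD _ _))// (le_trans (lerD (uC _) IH))//.
  rewrite exprD exprS le_eqVlt; apply/orP; left; apply/eqP; field.
  by rewrite gt_eqF.
have tail' n k : `|u (n + k)%N - u n| <= C / (1 - b) * b ^+ n.
  rewrite (le_trans (tail n k))// ler_piMr//; last by rewrite gerBl exprn_ge0.
  by apply: mulr_ge0; rewrite ?exprn_ge0// divr_ge0// ltW.
have cu : cvgn u.
  have -> : u = (fun n => u 0%N + series (telescope u) n).
    by apply/funext => n; rewrite (eq_sum_telescope u).
  apply: is_cvgD; first exact: is_cvg_cst.
  apply: normed_cvg; apply: (@series_le_cvg _ _ (geometric C b)) => //.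
  - by move=> n; exact: normr_ge0.
  - by move=> n; rewrite geometric_ge0.
  - by apply: is_cvg_geometric_series; rewrite ger0_norm.
exists (limn u) => //; exists (C / (1 - b)); first by rewrite divr_ge0// ltW.
move=> n; rewrite distrC.
have cn : `|u (n + k)%N - u n| @[k --> \oo] --> `|limn u - u n|.
  apply: cvg_norm; apply: cvgB; last exact: cvg_cst.
  by apply: (@cvg_comp _ _ _ (addn n) u _ \oo) => //; exact: cvg_addnl.
apply: (cvgr_to_le cn).
exact: nearW.
Qed.

End geometric_bounds.

(** * Self-normalized sums of an explosive sequence *)

Definition ar1_sum (R : realType) (i : R) (z : nat -> R) (n : nat) : R :=
  \sum_(k < n) i ^+ (n.-1 - k) * z k.

Lemma ar1_sumS (R : realType) (i : R) (z : nat -> R) n :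
  ar1_sum i z n.+1 = i * ar1_sum i z n + z n.
Proof.
rewrite /ar1_sum big_ord_recr/= subnn expr0 mul1r mulr_sumr; congr (_ + _).
apply: eq_bigr => k _; rewrite mulrA -exprS; congr (_ ^+ _ * _).
by have := ltn_ord k; lia.
Qed.

Section self_normalized_sums.
Context (R : realType) (lam rho b : R) (z : nat -> R).
Hypotheses (lam1 : 1 < `|lam|) (lamb : `|lam^-1| < b) (rho1 : 1 <= rho).
Hypotheses (rhob : rho * b < 1) (z_rho : geo_bounded rho z).
Local Notation i := (lam^-1).
Local Notation V := (ar1_sum i z).

Let lam0 : lam != 0.
Proof. by rewrite -normr_gt0 (lt_trans _ lam1). Qed.

Let i0 : i != 0. Proof. by rewrite invr_eq0. Qed.

Let i1 : `|i| < 1.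
Proof. by rewrite normfV invf_lt1// (lt_trans _ lam1). Qed.

Let b0 : 0 < b. Proof. by rewrite (le_lt_trans _ lamb). Qed.

Let rho_b : 0 <= rho * b < 1.
Proof. by rewrite rhob andbT mulr_ge0 ?(ltW b0)// (le_trans _ rho1). Qed.

Let b_rhob : b <= rho * b. Proof. by rewrite ler_peMl// ltW. Qed.

Let b1 : b < 1.
Proof. by case/andP: rho_b => _; exact: le_lt_trans. Qed.

Let i2 : 0 < 1 - i ^+ 2.
Proof. by rewrite subr_gt0 -real_normK ?num_real// expr_lt1. Qed.

Let i2b : `|i ^+ 2| < b.
Proof. by rewrite normrX (le_lt_trans _ lamb)// expr2 ler_piMr// ltW. Qed.

Lemma ar1_sum_bounded : geo_bounded rho V.
Proof.
by apply: (@geo_bounded_rec _ _ i _ z); [exact: lt_le_trans rho1|..|exact: ar1_sumS].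
Qed.

(** After division by [lam ^ n] both sums satisfy contracting linear recursions:
    the numerator is asymptotic to [lam^-1 * l * V n], the sum of squares tends
    to the fixed point [Bl] of its recursion.  The rate [b] of [x] compensates
    the growth [rho] of [z] because [rho * b < 1]; this is what makes the errors
    vanish even though [V n] itself need not stay bounded. *)
Lemma self_normalized_cvg (x : nat -> R) (l : R) : l != 0 ->
  geo_bounded b (fun n => i ^+ n * x n - l) ->
  (\sum_(k < n) z k * x k) / Num.sqrt (\sum_(k < n) x k ^+ 2) -
    Num.sg lam ^+ n.+1 * Num.sg l * (Num.sqrt (1 - i ^+ 2) * V n)
  @[n --> \oo] --> 0.
Proof.
move=> l0 xl.
pose s := Num.sg lam; pose kap := Num.sqrt (1 - i ^+ 2).
have kap0 : 0 < kap by rewrite sqrtr_gt0.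
have sE : s = Num.sg i by rewrite sgrV.
have ss n : s ^+ n * s ^+ n = 1.
  by rewrite -exprMn sE -expr2 sqr_sg i0 expr1n.
pose A n := i ^+ n * \sum_(k < n) z k * x k.
pose B n := i ^+ n * i ^+ n * \sum_(k < n) x k ^+ 2.
pose Bl := i ^+ 2 * l ^+ 2 / (1 - i ^+ 2).
have Bl0 : 0 < Bl by rewrite divr_gt0// mulr_gt0 ?exprn_even_gt0.
have sBl : Num.sqrt Bl = `|i| * `|l| / kap.
  rewrite /Bl -exprMn sqrtrM ?sqr_ge0// sqrtr_sqr normrM sqrtrV//.
  exact: ltW.
have sBl0 : 0 < Num.sqrt Bl by rewrite sqrtr_gt0.
pose D n := A n - i * l * V n.
have D_geo : geo_bounded (rho * b) D.
  apply: (@geo_bounded_rec _ _ i _ (fun n => i * (z n * (i ^+ n * x n - l)))).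
  - exact: lt_le_trans b_rhob.
  - exact/geo_boundedZ/geo_boundedM.
  - move=> n; rewrite /D ar1_sumS /A big_ord_recr/= exprS; ring.
have E_geo : geo_bounded b (fun n => B n - Bl).
  apply: (@geo_bounded_rec _ _ (i ^+ 2) _ (fun n => i ^+ 2 *
    ((i ^+ n * x n - l) * (i ^+ n * x n - l) + 2 * l * (i ^+ n * x n - l)))) => //.
  - apply/geo_boundedZ/geo_boundedD; last exact/geo_boundedZ.
    have := geo_boundedM xl xl; apply: geo_boundedS.
    by rewrite mulr_ge0 ?(ltW b0)//= ler_piMl ?(ltW b0) ?(ltW b1).
  - move=> n; rewrite /B big_ord_recr/= exprS /Bl; field.
    by rewrite lam0 /= gt_eqF// subr_gt0 -real_normK ?num_real// expr_gt1.
have B_cvg : B @ \oo --> Bl.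
  rewrite -[B](subrK (cst Bl)) -[X in _ --> X]add0r.
  apply: cvgD; last exact: cvg_cst.
  apply: geo_bounded_cvg0 E_geo; rewrite (ltW b0)/=.
  exact: b1.
have sB_cvg : Num.sqrt (B n) @[n --> \oo] --> Num.sqrt Bl.
  by apply: continuous_cvg => //; exact: sqrt_continuous.
have VE_cvg : V n * (B n - Bl) @[n --> \oo] --> 0.
  exact/(geo_bounded_cvg0 rho_b)/geo_boundedM/E_geo/ar1_sum_bounded.
have D_cvg : D @ \oo --> 0 by exact: geo_bounded_cvg0 D_geo.
(* the conjugate-quotient form of [1 / sqrt (B n) - 1 / sqrt Bl] keeps the
   factor [B n - Bl] next to [V n], where only their product is small *)
pose F n := D n * (Num.sqrt (B n))^-1 - i * l * (V n * (B n - Bl)) *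
  (Num.sqrt (B n) * Num.sqrt Bl * (Num.sqrt (B n) + Num.sqrt Bl))^-1.
have F_cvg : F @ \oo --> 0.
  rewrite -[X in _ --> X](_ : 0 * (Num.sqrt Bl)^-1 - i * l * 0 *
    (Num.sqrt Bl * Num.sqrt Bl * (Num.sqrt Bl + Num.sqrt Bl))^-1 = 0); last first.
    by rewrite mulr0 !mul0r subr0.
  apply: cvgB.
    by apply: cvgM => //; apply: cvgV => //; rewrite gt_eqF.
  apply: cvgM; first by apply: cvgM => //; exact: cvg_cst.
  apply: cvgV; first by rewrite gt_eqF// !mulr_gt0// addr_gt0.
  apply: cvgM; last by apply: cvgD => //; exact: cvg_cst.
  by apply: cvgM => //; exact: cvg_cst.
apply: norm_cvg0; move/cvg_norm : F_cvg; rewrite normr0; apply: cvg_trans.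
apply: near_eq_cvg; near=> n.
have Bn0 : 0 < Num.sqrt (B n).
  by rewrite sqrtr_gt0; near: n; exact: (cvgr_gt _ B_cvg).
have rowE : (\sum_(k < n) z k * x k) / Num.sqrt (\sum_(k < n) x k ^+ 2) =
    s ^+ n * (A n / Num.sqrt (B n)).
  have -> : Num.sqrt (B n) = s ^+ n * i ^+ n * Num.sqrt (\sum_(k < n) x k ^+ 2).
    rewrite /B sqrtrM -?expr2 ?sqr_ge0// sqrtr_sqr normrX; congr (_ * _).
    by rewrite -exprMn sE -normrEsg.
  rewrite /A invfM; set S := Num.sqrt _; set S' := \sum_(k < n) _.
  rewrite invfM.
  transitivity (s ^+ n / s ^+ n * (i ^+ n / i ^+ n) * (S' * S^-1)); last by ring.
  by rewrite !divff ?mul1r// expf_eq0 ?(negbTE i0) ?andbF// sE sgr_eq0 (negbTE i0) andbF.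
rewrite rowE exprS -/s -/kap.
have -> : s * s ^+ n * Num.sg l * (kap * V n) =
    s ^+ n * (i * l / Num.sqrt Bl * V n).
  have -> : i * l / Num.sqrt Bl = s * Num.sg l * kap.
    rewrite sBl sE {1}[i]numEsg {1}[l]numEsg; field.
    by rewrite !normr_eq0 l0 i0 gt_eqF.
  by ring.
rewrite -mulrBr normrM normrX sE normr_sg i0 expr1n mul1r; congr `|_|.
rewrite /F /D.
have -> : B n - Bl = Num.sqrt (B n) ^+ 2 - Num.sqrt Bl ^+ 2.
  by rewrite !sqr_sqrtr// ltW// -sqrtr_gt0.
move: Bn0 sBl0; set p := Num.sqrt (B n); set q := Num.sqrt Bl => p0 q0.
field; rewrite lam0 !gt_eqF//; exact: addr_gt0.
Unshelve. all: by end_near. Qed.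

End self_normalized_sums.

(** * Block sums of the latest innovations *)

(** Weights of the [n./2] latest innovations, scaled to have unit sum of squares.
    The power of the sign of [lam] absorbs the alternation in [n] that a negative
    [lam] produces, so that the limit below is the same along all [n]. *)
Definition block_coef (R : realType) (lam : R) (n k : nat) : R :=
  Num.sg lam ^+ n.+1 * lam^-1 ^+ (n./2.-1 - k) /
  Num.sqrt (\sum_(j < n./2) (lam^-1 ^+ (n./2.-1 - j)) ^+ 2).

Definition block_sum (R : realType) (lam : R) (z : nat -> R) (n : nat) : R :=
  \sum_(k < n./2) block_coef lam n k * z (n - n./2 + k)%N.

Lemma cvg_half : (fun n => n./2) @ \oo --> \oo.
Proof.
move=> A [N _ NA]; exists (N.*2) => // n /= Nn; apply: NA => /=.
by rewrite -(doubleK N) half_leq.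
Qed.

Lemma half_split n : (2 <= n)%N ->
  [/\ (0 < n./2)%N, n = (n - n./2 + n./2)%N & (n - n./2 <= n./2.+1)%N].
Proof. by move=> n2; split; lia. Qed.

Lemma ar1_sum_addn (R : realType) (i : R) (z : nat -> R) p k :
  ar1_sum i z (p + k) =
  i ^+ k * ar1_sum i z p + ar1_sum i (fun j => z (p + j)%N) k.
Proof.
elim: k => [|k IH].
  by rewrite addn0 expr0 mul1r /ar1_sum big_ord0 addr0.
by rewrite addnS !ar1_sumS IH exprS; ring.
Qed.

Lemma sum_sqr_geometric (R : realType) (i : R) m :
  (1 - i ^+ 2) * (\sum_(j < m) (i ^+ (m.-1 - j)) ^+ 2) = 1 - i ^+ m ^+ 2.
Proof.
elim: m => [|m IH]; first by rewrite big_ord0 mulr0 expr0 expr1n subrr.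
rewrite big_ord_recr/= subnn expr0 expr1n.
rewrite (_ : \sum_(j < m) _ = i ^+ 2 * \sum_(j < m) (i ^+ (m.-1 - j)) ^+ 2).
  by rewrite mulrDr mulrCA IH [i ^+ m.+1]exprS; ring.
rewrite mulr_sumr; apply: eq_bigr => k _; rewrite -exprMn -exprS.
by congr (_ ^+ _ ^+ _); have := ltn_ord k; lia.
Qed.

Lemma sum_sqr_geometric_gt0 (R : realType) (i : R) m : (0 < m)%N ->
  0 < \sum_(j < m) (i ^+ (m.-1 - j)) ^+ 2.
Proof.
case: m => // m _; rewrite big_ord_recr/= subnn expr0 expr1n ltr_wpDl//.
by apply: sumr_ge0 => j _; exact: sqr_ge0.
Qed.

Lemma block_coef_neq0 (R : realType) (lam : R) n k : lam != 0 -> (2 <= n)%N ->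
  block_coef lam n k != 0.
Proof.
move=> lam0 n2; have [m0 _ _] := half_split n2.
rewrite !mulf_neq0 ?invr_eq0 ?expf_neq0 ?sgr_eq0 ?invr_eq0//.
by rewrite gt_eqF// sqrtr_gt0 sum_sqr_geometric_gt0.
Qed.

Lemma sum_block_coef_sqr (R : realType) (lam : R) n : lam != 0 -> (2 <= n)%N ->
  \sum_(k < n./2) block_coef lam n k ^+ 2 = 1.
Proof.
move=> lam0 n2; have [m0 _ _] := half_split n2.
pose S := \sum_(j < n./2) (lam^-1 ^+ (n./2.-1 - j)) ^+ 2.
have S0 : 0 < S by exact: sum_sqr_geometric_gt0.
transitivity (S / S); last by rewrite divff// gt_eqF.
rewrite {1}/S mulr_suml; apply: eq_bigr => k _.
rewrite /block_coef -/S expr_div_n exprMn sqr_sqrtr ?(ltW S0)//.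
by rewrite [Num.sg lam ^+ _ ^+ 2]exprAC sqr_sg lam0 expr1n mul1r.
Qed.

Section block_approximation.
Context (R : realType) (lam rho : R) (z : nat -> R).
Hypotheses (lam1 : 1 < `|lam|) (rho1 : 1 <= rho) (rho_lam : rho < `|lam|).
Hypothesis (z_rho : geo_bounded rho z).
Local Notation i := (lam^-1).
Local Notation V := (ar1_sum i z).

Let lam0 : lam != 0.
Proof. by rewrite -normr_gt0 (lt_trans _ lam1). Qed.

Let i0 : i != 0. Proof. by rewrite invr_eq0. Qed.

Let i1 : `|i| < 1.
Proof. by rewrite normfV invf_lt1// (lt_trans _ lam1). Qed.

Let i2 : 0 < 1 - i ^+ 2.
Proof. by rewrite subr_gt0 -real_normK ?num_real// expr_lt1. Qed.

(** The later half of the innovations carries the whole fluctuation: the earlier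
    half enters [V n] with weight [lam ^- n./2], which beats the growth rate
    [rho] of [z].  Halving at [n./2] is what later makes the block of [n] and
    the block of any [m >= 2 n] disjoint. *)
Lemma block_sum_approx :
  Num.sg lam ^+ n.+1 * (Num.sqrt (1 - i ^+ 2) * V n) - block_sum lam z n
  @[n --> \oo] --> 0.
Proof.
have [C C0 VC] := ar1_sum_bounded lam1 rho1 z_rho.
set kap := Num.sqrt _.
have kap0 : 0 < kap by rewrite sqrtr_gt0.
have kap1 : kap <= 1.
  by rewrite -sqrtr1 ler_wsqrtr// gerBl sqr_ge0.
pose g := rho * `|i|.
have g0 : 0 <= g by rewrite mulr_ge0// (le_trans _ rho1).
have g1 : g < 1.
  by rewrite /g normfV ltr_pdivrMr ?mul1r// (lt_trans _ lam1).
have h_cvg : (geometric (3 * C * rho) g) (n./2) @[n --> \oo] --> 0.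
  apply: (@cvg_comp _ _ _ (fun n => n./2) (geometric (3 * C * rho) g) _ \oo).
    exact: cvg_half.
  by apply: cvg_geometric; rewrite ger0_norm.
apply: norm_cvg0.
apply: (@squeeze_cvgr _ _ _ _ (cst 0) _ _ _ _ (cvg_cst _) h_cvg).
exists 2%N => // n /= n2; rewrite normr_ge0/=.
pose m := n./2; pose p := (n - m)%N.
have [m0 np pm] : [/\ (0 < m)%N, n = (p + m)%N & (p <= m.+1)%N] := half_split n2.
pose G := ar1_sum i (fun j => z (p + j)%N) m.
pose t := Num.sqrt (\sum_(j < m) (i ^+ (m.-1 - j)) ^+ 2).
have -> : block_sum lam z n = Num.sg lam ^+ n.+1 * (G / t).
  rewrite /block_sum /G /ar1_sum mulr_suml mulr_sumr.
  by apply: eq_bigr => k _; rewrite /block_coef -/m -/t; ring.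
rewrite -mulrBr normrM normrX normr_sg lam0 expr1n mul1r.
have VE : V n = i ^+ m * V p + G by rewrite {1}np ar1_sum_addn.
have kt : (kap * t) ^+ 2 = 1 - i ^+ m ^+ 2.
  rewrite exprMn !sqr_sqrtr ?sum_sqr_geometric ?(ltW i2)//.
  by apply: sumr_ge0 => j _; exact: sqr_ge0.
have e0 : 0 <= `|i| ^+ m by rewrite exprn_ge0.
have im2 : i ^+ m ^+ 2 = (`|i| ^+ m) ^+ 2 by rewrite -normrX real_normK ?num_real.
have t1 : 1 <= t.
  rewrite -sqrtr1 ler_wsqrtr//.
  case: (m) m0 => // k _; rewrite big_ord_recr/= subnn expr0 expr1n lerDr.
  by apply: sumr_ge0 => j _; exact: sqr_ge0.
have t0 : 0 < t by rewrite (lt_le_trans _ t1).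
have kt0 : 0 <= kap * t by rewrite mulr_ge0 ?ltW.
have kt1 : `|kap * t - 1| <= (`|i| ^+ m) ^+ 2.
  move: kt; rewrite im2; set e := (_ ^+ m) ^+ 2 => kt.
  have e_ge0 : 0 <= e by exact: sqr_ge0.
  by rewrite ler_norml; apply/andP; split; nra.
have kt2 : `|kap - t^-1| <= (`|i| ^+ m) ^+ 2.
  have -> : kap - t^-1 = (kap * t - 1) / t by field; rewrite gt_eqF.
  rewrite normrM (le_trans _ kt1)// ler_piMr ?normr_ge0//.
  by rewrite ger0_norm ?invr_ge0 ?(ltW t0)// invf_le1.
have rho0 : 0 <= rho by rewrite (le_trans _ rho1).
have rp : rho ^+ p <= rho * rho ^+ m.
  by rewrite -exprS ler_weXn2l.
have Vp : `|i ^+ m * V p| <= C * rho * g ^+ m.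
  rewrite normrM normrX mulrC (le_trans (ler_wpM2r e0 (VC p)))//.
  rewrite /g exprMn -!mulrA ler_wpM2l// mulrA ler_wpM2r//.
have Gn : `|G| <= 2 * C * rho ^+ n.
  have -> : G = V n - i ^+ m * V p by rewrite VE; ring.
  rewrite (le_trans (ler_normB _ _))// mulrDl mulrDl !mul1r lerD ?VC//.
  rewrite normrM normrX (le_trans (ler_wpM2l e0 (VC p)))//.
  rewrite mulrCA ler_wpM2l// -[leRHS]mul1r.
  apply: ler_pM; rewrite ?exprn_ge0//; last by rewrite ler_weXn2l// /p leq_subr.
  by rewrite exprn_ile1// ltW.
have -> : kap * V n - G / t = kap * (i ^+ m * V p) + G * (kap - t^-1).
  by rewrite VE; ring.
rewrite (le_trans (ler_normD _ _))//.
rewrite -/m.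
have -> : 3 * C * rho * g ^+ m = C * rho * g ^+ m + 2 * C * rho * g ^+ m by ring.
apply: lerD.
  rewrite normrM (le_trans _ Vp)// ler_piMl//.
  by rewrite ger0_norm// ltW.
rewrite normrM (le_trans (ler_pM _ _ Gn kt2))//.
have gm1 : g ^+ m <= 1 by rewrite exprn_ile1// ltW.
rewrite np exprD.
rewrite -!mulrA ler_wpM2l// ler_wpM2l//.
rewrite (@le_trans _ _ (rho * rho ^+ m * (rho ^+ m * (`|i| ^+ m) ^+ 2)))//.
  rewrite ler_wpM2r// mulr_ge0 ?exprn_ge0//.
have -> : rho * rho ^+ m * (rho ^+ m * (`|i| ^+ m) ^+ 2) = rho * (g ^+ m * g ^+ m).
  by rewrite /g exprMn; ring.
by rewrite ler_wpM2l// ler_piMl// exprn_ge0.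
Qed.

End block_approximation.

(** * Paths of an explosive autoregression *)

Section explosive_ar2_paths.
Context (R : realType) (lam mu : R).
Hypotheses (lam_mu : `|mu| < `|lam|) (lam1 : 1 < `|lam|).
Local Notation i := (lam^-1).

Let lam0 : lam != 0.
Proof. by rewrite -normr_gt0 (lt_trans _ lam1). Qed.

(** With [q = max(|mu|, 1) / |lam| < 1], a [rho] slightly above [1] and
    [b = rho * q] work, since [rho ^+ 2 * q < 1] for [rho = 1 + (1 - q) / 4]. *)
Lemma ar2_rates : exists rho b,
  [/\ 1 < rho < `|lam|, `|i| < b, `|mu / lam| < b, rho * `|i| <= b & rho * b < 1].
Proof.
pose q := Num.max `|mu| 1 / `|lam|.
have l0 : 0 < `|lam| by rewrite normr_gt0.
have q1 : q < 1 by rewrite ltr_pdivrMr// mul1r gt_max lam_mu.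
have iq : `|i| <= q.
  by rewrite normfV -[leLHS]mul1r ler_pM2r ?invr_gt0// le_max lexx orbT.
have mq : `|mu / lam| <= q.
  by rewrite normrM normfV ler_pM2r ?invr_gt0// le_max lexx.
have q0 : 0 < q by rewrite (lt_le_trans _ iq)// normr_gt0 invr_eq0.
have iE : `|i| = `|lam|^-1 by rewrite normfV.
exists (1 + (1 - q) / 4), ((1 + (1 - q) / 4) * q); split.
- apply/andP; split; first lra.
  rewrite -[ltRHS]invrK -iE -[ltRHS]mul1r ltr_pdivlMr ?normr_gt0 ?invr_eq0//.
  by apply: le_lt_trans (_ : (1 + (1 - q) / 4) * q < 1); [rewrite ler_wpM2l//; lra|nra].
- by rewrite (le_lt_trans iq)//; nra.
- by rewrite (le_lt_trans mq)//; nra.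
- by rewrite ler_wpM2l//; lra.
- nra.
Qed.

Lemma sgr_lead_sub : Num.sg (lam - mu) = Num.sg lam.
Proof.
have [l0|l0|l0] := ltgtP lam 0; last by have := lam0; rewrite l0 eqxx.
- have := lam_mu; rewrite ltr_norml (ltr0_norm l0) => /andP[h1 h2].
  by rewrite !ltr0_sg// subr_lt0; lra.
- have := lam_mu; rewrite ltr_norml (gtr0_norm l0) => /andP[h1 h2].
  by rewrite !gtr0_sg// subr_gt0; lra.
Qed.

(** Factoring the recursion, [x (n + 1) - mu * x n] is a first order process with
    ratio [lam], so after division by [lam ^ n] its increments are geometrically
    small and it converges to some [y]; then [lam ^- n * x n] converges to
    [y / (lam - mu)] at the same rate, and the self-normalized sums formed with
    [x k] and with [x (k + 1)] differ only by the sign of [lam]. *)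
Lemma ar2_self_normalized_cvg rho b (x z : nat -> R) :
  1 < rho < `|lam| -> `|i| < b -> `|mu / lam| < b ->
  rho * `|i| <= b -> rho * b < 1 ->
  geo_bounded rho z ->
  (forall k, x k.+2 = (lam + mu) * x k.+1 - lam * mu * x k + z k) ->
  exists2 y, i ^+ n * (x n.+1 - mu * x n) @[n --> \oo] --> y &
  y != 0 ->
    ((\sum_(k < n) z k * x k.+1) / Num.sqrt (\sum_(k < n) x k.+1 ^+ 2) -
       Num.sg y * block_sum lam z n @[n --> \oo] --> 0) /\
    ((\sum_(k < n) z k * x k) / Num.sqrt (\sum_(k < n) x k ^+ 2) -
       Num.sg y * Num.sg lam * block_sum lam z n @[n --> \oo] --> 0).
Proof.
move=> /andP[rho1 rho_lam] ib mb rib rhob zr xE.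
have rho0 : 0 <= rho by rewrite ltW// (lt_trans _ rho1).
have b0 : 0 < b by rewrite (le_lt_trans _ ib).
have b1 : b < 1 by nra.
pose Y n := i ^+ n * (x n.+1 - mu * x n).
have [y Yy Y_geo] : exists2 l, Y @ \oo --> l & geo_bounded b (fun n => Y n - l).
  apply: geo_bounded_cvg; first by rewrite ltW.
  have -> : (fun n => Y n.+1 - Y n) = (fun n => i * (z n * i ^+ n)).
    by apply/funext => n; rewrite /Y xE exprS; field.
  apply: (@geo_boundedS _ (rho * `|i|)); first by rewrite mulr_ge0.
  apply/geo_boundedZ/geo_boundedM => //.
  by exists 1 => // n; rewrite normrX mul1r.
exists y => // y0.
have lm0 : lam - mu != 0.
  by rewrite subr_eq0; apply: contraTneq lam_mu => ->; rewrite ltxx.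
pose L := y / (lam - mu).
have L0 : L != 0 by rewrite mulf_neq0// invr_eq0.
have sL : Num.sg L = Num.sg y * Num.sg lam.
  by rewrite sgrM sgrV sgr_lead_sub.
have s2 : Num.sg lam * Num.sg lam = 1 by rewrite -expr2 sqr_sg lam0.
have xL : geo_bounded b (fun n => i ^+ n * x n - L).
  apply: (@geo_bounded_rec _ _ (mu / lam) _ (fun n => i * (Y n - y))) => //.
    exact: geo_boundedZ.
  by move=> n; rewrite /Y /L exprS; field; rewrite lam0.
have xL' : geo_bounded b (fun n => i ^+ n * x n.+1 - lam * L).
  have -> : (fun n => i ^+ n * x n.+1 - lam * L) =
            (fun n => lam * (i ^+ n.+1 * x n.+1 - L)).
    by apply/funext => n; rewrite exprS; field.
  apply: geo_boundedZ; have [C C0 xC] := xL.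
  by exists (C * b) => [|n]; rewrite ?mulr_ge0 ?(ltW b0)// -mulrA -exprS.
have approx (c : R) (f : nat -> R) :
    f n - Num.sg lam ^+ n.+1 * c * (Num.sqrt (1 - i ^+ 2) * ar1_sum i z n)
      @[n --> \oo] --> 0 ->
    f n - c * block_sum lam z n @[n --> \oo] --> 0.
  move=> fc; have bc := block_sum_approx lam1 (ltW rho1) rho_lam zr.
  have -> : (fun n => f n - c * block_sum lam z n) = (fun n =>
      (f n - Num.sg lam ^+ n.+1 * c * (Num.sqrt (1 - i ^+ 2) * ar1_sum i z n)) +
      c * (Num.sg lam ^+ n.+1 * (Num.sqrt (1 - i ^+ 2) * ar1_sum i z n) -
        block_sum lam z n)).
    by apply/funext => n; ring.
  rewrite -[X in _ --> X]addr0 -[X in _ --> _ + X](mulr0 c).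
  by apply: cvgD => //; apply: cvgM => //; exact: cvg_cst.
split; apply: approx.
- have := @self_normalized_cvg _ lam rho b z lam1 ib (ltW rho1) rhob zr _ (lam * L) _ xL'.
  by rewrite sgrM sL (mulrCA _ (Num.sg y)) s2 mulr1 mulf_neq0//; exact.
- have := self_normalized_cvg lam1 ib (ltW rho1) rhob zr L0 xL.
  by rewrite sL.
Qed.

End explosive_ar2_paths.

(** * Independence *)

Section independence_of_generated_sigma_algebras.
Context d (T : measurableType d) (R : realType) (P : probability T R).
Implicit Types (F G : set (set T)) (A B D : set T).

Lemma independent_sigmaC F G :
  independent_sigma P F G -> independent_sigma P G F.
Proof. by move=> FG A B GA FB; rewrite setIC FG// muleC. Qed.

Lemma sub_independent_sigma F G F' G' : F' `<=` F -> G' `<=` G ->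
  independent_sigma P F G -> independent_sigma P F' G'.
Proof. by move=> FF GG FG A B /FF FA /GG GB; exact: FG. Qed.

Lemma independent_sigma_genl F G : F `<=` measurable -> setI_closed F ->
  F setT -> G `<=` measurable ->
  independent_sigma P F G -> independent_sigma P <<s F >> G.
Proof.
move=> Fm FI FT Gm FG A B sFA GB.
have mB : measurable B by exact: Gm.
have PB_ge0 : 0 <= fine (P B) by rewrite fine_ge0.
pose r : {nonneg R} := NngNum PB_ge0.
have PBE : (r%:num)%:E = P B by rewrite /= fineK// fin_num_measure.
transitivity (mrestr P mB A); first by [].
transitivity (mscale r P A); last by rewrite muleC -PBE.
apply: (g_sigma_algebra_measure_unique F Fm (fun=> setT)) => //.
- by rewrite bigcup_const//; exists 0%N.
- move=> C FC; transitivity (P (C `&` B)) => //; rewrite FG// muleC -PBE//.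
- move=> _; change (P (setT `&` B) < +oo)%E; rewrite setTI.
  by rewrite (le_lt_trans (probability_le1 P mB))// ltry.
Qed.

(** One side at a time: with the other event fixed, the two sides of the product
    rule are finite measures that agree on a pi-system. *)
Lemma independent_sigma_gen F G :
  F `<=` measurable -> setI_closed F -> F setT ->
  G `<=` measurable -> setI_closed G -> G setT ->
  independent_sigma P F G -> independent_sigma P <<s F >> <<s G >>.
Proof.
move=> Fm FI FT Gm GI GT FG.
have sm : <<s F >> `<=` measurable.
  exact: smallest_sub (@sigma_algebra_measurable _ T) Fm.
apply: independent_sigmaC; apply: independent_sigma_genl => //.
by apply: independent_sigmaC; exact: independent_sigma_genl.
Qed.

End independence_of_generated_sigma_algebras.

(** Letting [B k] be the whole line off [I] and from some [n] on, instead of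
    intersecting over a finite set of indices, makes stability under intersection
    immediate. *)
Definition cylinders d (T : measurableType d) (R : realType)
    (P : probability T R) (Y : nat -> {RV P >-> R}) (I : set nat) :
    set (set T) :=
  [set A | exists2 B : nat -> set R,
     (forall k, measurable (B k)) /\
     (exists n, forall k, ~ (I k /\ (k < n)%N) -> B k = setT) &
     A = \bigcap_k (Y k @^-1` B k)].

Section disjoint_blocks.
Context d (T : measurableType d) (R : realType) (P : probability T R).
Variable Y : nat -> {RV P >-> R}.
Implicit Types (I J : set nat).

Lemma cylinders_measurable I : cylinders Y I `<=` measurable.
Proof.
move=> _ [B [mB _] ->]; apply: bigcapT_measurable => k.
by rewrite -[X in measurable X]setTI; exact: measurable_funP.
Qed.

Lemma cylinders_setT I : cylinders Y I setT.
Proof.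
exists (fun=> setT); first by split => //; exists 0%N.
by apply/seteqP; split.
Qed.

Lemma cylinders_setI I : setI_closed (cylinders Y I).
Proof.
move=> _ _ [B [mB [n nB]] ->] [C [mC [m mC']] ->].
exists (fun k => B k `&` C k).
  split; first by move=> k; exact: measurableI.
  exists (maxn n m) => k Ik; rewrite nB ?mC' ?setTI// => -[kI kn]; apply: Ik;
    split => //; lia.
rewrite -bigcapI; apply: eq_bigcapr => k _.
by rewrite preimage_setI.
Qed.

Lemma sub_cylinders I J : I `<=` J -> cylinders Y I `<=` cylinders Y J.
Proof.
move=> IJ _ [B [mB [n nB]] ->]; exists B => //; split => //; exists n => k kJ.
by apply: nB => -[/IJ Jk kn]; exact: kJ.
Qed.

Lemma cylinders_coord I k (B : set R) : I k -> measurable B ->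
  cylinders Y I (Y k @^-1` B).
Proof.
move=> Ik mB; exists (fun j => if j == k then B else setT).
  split; first by move=> j; case: ifP.
  exists k.+1 => j; case: ifP => // /eqP -> []; split => //; exact: ltnSn.
apply/seteqP; split => [w /= wB j _ /=|w /= /(_ k Logic.I)]; rewrite ?eqxx//.
by case: ifP => // /eqP ->.
Qed.

Lemma cylinders_probability (B : nat -> set R) n :
  mutually_independent Y -> (forall k, measurable (B k)) ->
  (forall k, (n <= k)%N -> B k = setT) ->
  P (\bigcap_k (Y k @^-1` B k)) = (\prod_(k <- iota 0 n) P (Y k @^-1` B k))%E.
Proof.
move=> iY mB nB; rewrite -iY ?iota_uniq//; congr (P _).
apply/seteqP; split => [w wB k _|w wB k _]; first exact: wB.
have [kn|kn] := ltnP k n; first by apply: wB => /=; rewrite mem_iota.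
by rewrite nB.
Qed.

(** At each index at most one of the two cylinders imposes a condition, so the
    product over all indices splits into the product of the two products. *)
Lemma independent_disjoint_blocks I J :
  mutually_independent Y -> I `&` J = set0 ->
  independent_sigma P <<s cylinders Y I >> <<s cylinders Y J >>.
Proof.
move=> iY IJ; apply: independent_sigma_gen;
  try exact: cylinders_measurable; try exact: cylinders_setI;
  try exact: cylinders_setT.
move=> _ _ [B [mB [n nB]] ->] [C [mC [m mC']] ->].
have -> : \bigcap_k (Y k @^-1` B k) `&` \bigcap_k (Y k @^-1` C k) =
    \bigcap_k (Y k @^-1` (B k `&` C k)).
  by rewrite -bigcapI; apply: eq_bigcapr => k _; rewrite preimage_setI.
pose N := maxn n m.
have BN k : (N <= k)%N -> B k = setT.
  by move=> Nk; apply: nB => -[_]; rewrite /N in Nk; lia.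
have CN k : (N <= k)%N -> C k = setT.
  by move=> Nk; apply: mC' => -[_]; rewrite /N in Nk; lia.
rewrite !(@cylinders_probability _ N) => //; last 2 first.
  by move=> k; exact: measurableI.
  by move=> k Nk; rewrite BN// CN// setTI.
rewrite -big_split/=; apply: eq_bigr => k _.
have [Ik|nIk] := pselect (I k).
  rewrite (mC' k) ?setIT ?preimage_setT ?probability_setT ?mule1// => -[Jk _].
  by have : (I `&` J) k by []; rewrite IJ.
by rewrite (nB k) ?setTI ?preimage_setT ?probability_setT ?mul1e// => -[].
Qed.

Lemma sub_sigma_seq I : <<s cylinders Y I >> `<=` sigma_seq Y.
Proof.
apply: smallest_sub; first exact: smallest_sigma_algebra.
move=> _ [B [mB _] ->]; pose T' := g_sigma_algebraType
  (\bigcup_k preimage_set_system setT (Y k) measurable).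
have : measurable (\bigcap_k (Y k @^-1` B k) : set T').
  apply: bigcapT_measurable => k; apply: sub_sigma_algebra; exists k => //.
  by exists (B k) => //; rewrite setTI.
by [].
Qed.

End disjoint_blocks.

(** The family of events is an argument, so that different sub-sigma-algebras of
    one space can be compared. *)
Definition measurable_wrt T (R : realType) (G : set (set T)) (f : T -> R) :=
  forall B, measurable B -> G (f @^-1` B).

Section measurable_wrt.
Context d (T : measurableType d) (R : realType).
Implicit Types (F G : set (set T)) (f : T -> R).

Lemma measurable_wrtP G f : measurable_wrt <<s G >> f <->
  measurable_fun setT (f : g_sigma_algebraType G -> R).
Proof.
split=> [Gf _ B mB|mf B mB]; first by rewrite setTI; exact: Gf.
by have := mf measurableT B mB; rewrite setTI.
Qed.

Lemma measurable_wrt_sub F G f : F `<=` G ->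
  measurable_wrt F f -> measurable_wrt G f.
Proof. by move=> FG mf B mB; apply: FG; exact: mf. Qed.

Lemma measurable_wrt_measurable G f :
  G `<=` measurable -> measurable_wrt G f -> measurable_fun setT f.
Proof. by move=> Gm fG _ B mB; rewrite setTI; apply: Gm; exact: fG. Qed.

End measurable_wrt.

(** Stated for plain functions, not for bundled random variables, because the
    variables of interest are sums and limits. *)
Definition independent_funs d (T : measurableType d) (R : realType)
    (P : probability T R) (U V : T -> R) :=
  forall A B, measurable A -> measurable B ->
  P (U @^-1` A `&` V @^-1` B) = (P (U @^-1` A) * P (V @^-1` B))%E.

Section product_law.
Context d (T : measurableType d) (R : realType) (P : probability T R).

Lemma independent_sigma_funs F G (U V : T -> R) : independent_sigma P F G ->
  measurable_wrt F U -> measurable_wrt G V -> independent_funs P U V.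
Proof. by move=> FG FU GV A B mA mB; apply: FG; [exact: FU|exact: GV]. Qed.

Lemma independent_funs_joint_law (U V : {RV P >-> R}) : independent_funs P U V ->
  forall X : set (R * R), measurable X ->
  (distribution P U \x distribution P V)%E X = P ((fun w => (U w, V w)) @^-1` X).
Proof.
move=> UV X mX.
have mUV : measurable_fun setT (fun w => (U w, V w)).
  by apply: measurable_fun_pair => //; exact: measurable_funP.
pose W : {RV P >-> (R * R)%type} :=
  HB.pack (fun w => (U w, V w)) (isMeasurableFun.Build _ _ _ _ _ mUV).
apply: (@product_measure_unique _ _ _ _ _ (distribution P U) (distribution P V)
  (distribution P W) _ _ mX) => A B mA mB; exact: UV.
Qed.

End product_law.

(** * Gaussian measures *)

Section normal_measures.
Context (R : realType).
Local Notation mu := (@lebesgue_measure R).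
Implicit Types (m c s t : R) (A : set R).

Lemma measurable_affine m c : measurable_fun setT (fun x : R => m + c * x).
Proof. by apply: measurable_funD => //; exact: measurable_funM. Qed.

Lemma measurable_affine_preimage m c A : measurable A ->
  measurable ((fun x : R => m + c * x) @^-1` A).
Proof.
move=> mA; rewrite -[X in measurable X]setTI.
exact: (measurable_affine m c).
Qed.

Lemma lebesgue_measure_affine m c A : c != 0 -> measurable A ->
  (`|c|%:E * mu ((fun x => (m + c * x)%R) @^-1` A) = mu A)%E.
Proof.
move=> c0 mA.
pose r : {nonneg R} := NngNum (normr_ge0 c).
pose f : measurableTypeR R -> measurableTypeR R := fun x => m + c * x.
have mf : measurable_fun setT f by exact: measurable_affine.
pose pf : {measure set (measurableTypeR R) -> \bar R} := pushforward mu f.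
apply/esym; apply: (@lebesgue_measure_unique _ (mscale r (pf mf))) => //.
move=> _ [[a b]] _ <-.
change (mu `]a, b] = `|c|%:E * mu (f @^-1` `]a, b]))%E.
rewrite lebesgue_measure_itv/= lte_fin.
have [c_gt0|c_lt0|c_eq0] := ltgtP 0 c; last by rewrite -c_eq0 eqxx in c0.
- have -> : f @^-1` `]a, b] = `](a - m) / c, (b - m) / c]%classic.
    apply/seteqP; split=> x; rewrite /f /= !in_itv/= ltr_pdivrMr// ler_pdivlMr//;
    by rewrite ltrBlDl lerBrDl [x * c]mulrC.
  rewrite lebesgue_measure_itv/= lte_fin ltr_pM2r ?invr_gt0// ltrD2r.
  case: ifPn => _; last by rewrite mule0.
  by rewrite -!EFinB -EFinM gtr0_norm//; congr (_%:E); field; rewrite gt_eqF.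
- have -> : f @^-1` `]a, b] = `[(b - m) / c, (a - m) / c[%classic.
    apply/seteqP; split=> x; rewrite /f /= !in_itv/= ler_ndivrMr// ltr_ndivlMr//;
    by rewrite ltrBlDl lerBrDl [x * c]mulrC andbC.
  rewrite lebesgue_measure_itv/= lte_fin ltr_nM2r ?invr_lt0// ltrD2r.
  case: ifPn => _; last by rewrite mule0.
  by rewrite -!EFinB -EFinM ltr0_norm//; congr (_%:E); field; rewrite lt_eqF.
Qed.

Lemma ge0_integral_affine m c A (g : R -> \bar R) : c != 0 ->
  measurable A -> measurable_fun setT g -> (forall x, 0 <= g x)%E ->
  (`|c|%:E * \int[mu]_(x in (fun x => (m + c * x)%R) @^-1` A) g (m + c * x)%R =
   \int[mu]_(x in A) g x)%E.
Proof.
move=> c0 mA mg g0.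
pose r : {nonneg R} := NngNum (normr_ge0 c).
pose f : measurableTypeR R -> measurableTypeR R := fun x => m + c * x.
have mf : measurable_fun setT f by exact: measurable_affine.
pose pf : {measure set (measurableTypeR R) -> \bar R} := pushforward mu f.
transitivity (\int[mscale r (pf mf)]_(x in A) g x)%E; last first.
  apply: eq_measure_integral => B mB _.
  exact: (lebesgue_measure_affine m).
rewrite ge0_integral_mscale//; last exact: measurable_funTS.
by rewrite ge0_integral_pushforward//; exact: measurable_funTS.
Qed.

Lemma normal_pdf_affine m c s x : c != 0 -> 0 < s ->
  `|c| * normal_pdf m (`|c| * s) (m + c * x) = normal_pdf 0 s x.
Proof.
move=> c0 s0.
have cs0 : `|c| * s != 0 by rewrite mulf_neq0 ?normr_eq0// gt_eqF.
rewrite !normal_pdfE// ?gt_eqF// mulrA; congr (_ * _).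
  rewrite /normal_peak exprMn real_normK ?num_real//.
  rewrite -mulrA -mulrnAr sqrtrM ?sqr_ge0// sqrtr_sqr invfM mulrA.
  by rewrite divff ?normr_eq0// mul1r.
rewrite /normal_fun; congr expR.
rewrite exprMn real_normK ?num_real//; field.
by rewrite c0 gt_eqF.
Qed.

Lemma normal_prob_affine m c s A : c != 0 -> 0 < s -> measurable A ->
  normal_prob 0 s ((fun x => m + c * x) @^-1` A) = normal_prob m (`|c| * s) A.
Proof.
move=> c0 s0 mA; rewrite /normal_prob.
have mpdf : measurable_fun setT (EFin \o normal_pdf m (`|c| * s)).
  apply/measurable_EFinP; exact: measurable_normal_pdf.
rewrite -(ge0_integral_affine m c0 mA mpdf); last first.
  by move=> x; rewrite lee_fin normal_pdf_ge0.
rewrite -ge0_integralZl//; last 3 first.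
- exact: measurable_affine_preimage.
- apply/measurable_funTS/measurable_EFinP.
  by apply: measurableT_comp; [exact: measurable_normal_pdf|exact: measurable_affine].
- by move=> x _; rewrite lee_fin normal_pdf_ge0.
by apply: eq_integral => x _; rewrite -EFinM normal_pdf_affine.
Qed.

(** The measure is defined by a density, and densities are unique almost
    everywhere, so its Radon-Nikodym derivative is that density. *)
Lemma ge0_integral_normal_prob m s (g : R -> \bar R) :
  measurable_fun setT g -> (forall x, 0 <= g x)%E ->
  (\int[normal_prob m s]_x g x = \int[mu]_x (g x * (normal_pdf m s x)%:E))%E.
Proof.
move=> mg g0.
have dom : normal_prob m s `<< mu := normal_prob_dominates m s.
rewrite -(Radon_Nikodym_SigmaFinite.change_of_variables dom)//.
have mRN : measurable_fun setT (Radon_Nikodym_SigmaFinite.f (normal_prob m s) mu).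
  exact: measurable_int (Radon_Nikodym_SigmaFinite.f_integrable dom).
apply: ae_eq_integral => //.
- exact: emeasurable_funM.
- by apply: emeasurable_funM => //; apply/measurable_EFinP; exact: measurable_normal_pdf.
apply: ae_eqe_mul2l; apply: integral_ae_eq => //.
- exact: Radon_Nikodym_SigmaFinite.f_integrable.
- apply/measurable_EFinP; exact: measurable_normal_pdf.
- by move=> E _ mE; rewrite -Radon_Nikodym_SigmaFinite.f_integral.
Qed.

(** Completing the square: the product is a Gaussian density in [z] times a
    Gaussian density in [x], and the latter integrates to one. *)
Lemma normal_pdf_mul s t x z : 0 < s -> 0 < t ->
  normal_pdf 0 s x * normal_pdf x t z =
  normal_pdf 0 (Num.sqrt (s ^+ 2 + t ^+ 2)) z *
  normal_pdf (z * s ^+ 2 / (s ^+ 2 + t ^+ 2))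
    (s * t / Num.sqrt (s ^+ 2 + t ^+ 2)) x.
Proof.
move=> s0 t0.
have st0 : 0 < s ^+ 2 + t ^+ 2 by rewrite addr_gt0// exprn_gt0.
set r := Num.sqrt _.
have r0 : 0 < r by rewrite sqrtr_gt0.
have r2 : r ^+ 2 = s ^+ 2 + t ^+ 2 by rewrite sqr_sqrtr// ltW.
have str0 : 0 < s * t / r by rewrite !mulr_gt0// invr_gt0.
rewrite !normal_pdfE ?gt_eqF// mulrACA [RHS]mulrACA; congr (_ * _).
  rewrite /normal_peak -!invfM -!sqrtrM; last 2 first.
  - by rewrite mulrn_wge0// mulr_ge0 ?sqr_ge0// pi_ge0.
  - by rewrite mulrn_wge0// mulr_ge0 ?sqr_ge0// pi_ge0.
  congr (Num.sqrt _)^-1; rewrite exprMn exprVn r2.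
  by field; rewrite gt_eqF.
rewrite /normal_fun -!expRD; congr expR.
rewrite exprMn exprVn r2; field.
by rewrite !gt_eqF.
Qed.

Lemma measurable_normal_pdf_mean t : 0 < t ->
  measurable_fun setT (fun p : R * R => normal_pdf p.1 t p.2).
Proof.
move=> t0.
have -> : (fun p : R * R => normal_pdf p.1 t p.2) =
          (fun p => normal_pdf 0 t (p.2 - p.1)).
  by apply/funext => p; rewrite !normal_pdfE ?gt_eqF// /normal_fun subr0.
apply: measurableT_comp; first exact: measurable_normal_pdf.
exact: measurable_funB.
Qed.

Lemma normal_prob_indic m t A :
  normal_prob m t A = (\int[mu]_z ((\1_A z)%:E * (normal_pdf m t z)%:E))%E.
Proof.
rewrite /normal_prob integral_mkcond; apply: eq_integral => z _.
rewrite patchE indicE; case: (z \in A); last by rewrite mul0e.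
by rewrite mul1e.
Qed.

Lemma measurable_indic_normal_pdf t A : 0 < t -> measurable A ->
  measurable_fun setT
    (fun p : R * R => (\1_A p.2)%:E * (normal_pdf p.1 t p.2)%:E)%E.
Proof.
move=> t0 mA; apply: emeasurable_funM; apply/measurable_EFinP.
  by apply: measurableT_comp => //; exact: measurable_indic.
exact: measurable_normal_pdf_mean.
Qed.

Lemma measurable_normal_prob_mean t A : 0 < t -> measurable A ->
  measurable_fun setT (fun m => normal_prob m t A).
Proof.
move=> t0 mA; under eq_fun do rewrite normal_prob_indic.
apply: (measurable_fun_fubini_tonelli_F (m2 := mu) 
  (fun p : R * R => (\1_A p.2)%:E * (normal_pdf p.1 t p.2)%:E)%E).
- exact: measurable_indic_normal_pdf.
- by move=> p; rewrite -EFinM lee_fin mulr_ge0 ?normal_pdf_ge0.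
Qed.

Lemma normal_prob_conv s t A : 0 < s -> 0 < t -> measurable A ->
  (\int[normal_prob 0 s]_x normal_prob x t A =
   normal_prob 0 (Num.sqrt (s ^+ 2 + t ^+ 2)) A)%E.
Proof.
move=> s0 t0 mA.
pose F (p : R * R) : \bar R := ((\1_A p.2)%:E * (normal_pdf p.1 t p.2)%:E)%E.
have mF : measurable_fun setT F by exact: measurable_indic_normal_pdf.
have F0 p : (0 <= F p)%E.
  by rewrite /F -EFinM lee_fin mulr_ge0 ?normal_pdf_ge0.
rewrite ge0_integral_normal_prob; last 2 first.
- exact: measurable_normal_prob_mean.
- by move=> x; exact: measure_ge0.
under eq_integral do rewrite normal_prob_indic.
have mpdf1 : measurable_fun setT (fun p : R * R => (normal_pdf 0 s p.1)%:E).
  by apply/measurable_EFinP; apply: measurableT_comp => //; exact: measurable_normal_pdf.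
transitivity (\int[mu]_x \int[mu]_z (F (x, z) * (normal_pdf 0 s x)%:E))%E.
  apply: eq_integral => x _; rewrite ge0_integralZr ?lee_fin ?normal_pdf_ge0//.
  by apply: measurableT_comp => //; exact: measurable_pair1.
transitivity (\int[mu]_z \int[mu]_x (F (x, z) * (normal_pdf 0 s x)%:E))%E.
  apply: (@fubini_tonelli _ _ _ _ _ mu mu
    (fun p : R * R => F p * (normal_pdf 0 s p.1)%:E)%E).
  - exact: emeasurable_funM.
  - by move=> p; rewrite mule_ge0// lee_fin normal_pdf_ge0.
rewrite /normal_prob [in RHS]integral_mkcond; apply: eq_integral => z _.
rewrite patchE; set r := Num.sqrt _.
transitivity (\int[mu]_x ((\1_A z)%:E * (normal_pdf 0 r z)%:E *
  (normal_pdf (z * s ^+ 2 / (s ^+ 2 + t ^+ 2)) (s * t / r) x)%:E))%E.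
  apply: eq_integral => x _; rewrite /F/= -!EFinM; congr (_%:E).
  by rewrite -mulrA [_ * normal_pdf 0 s x]mulrC normal_pdf_mul// mulrA.
rewrite ge0_integralZl//; last 3 first.
- apply/measurable_EFinP; exact: measurable_normal_pdf.
- by move=> x _; rewrite lee_fin normal_pdf_ge0.
- by rewrite -EFinM lee_fin mulr_ge0 ?normal_pdf_ge0.
rewrite integral_normal_pdf mule1 indicE; case: (z \in A); last by rewrite mul0e.
by rewrite mul1e.
Qed.

End normal_measures.

(** * Laws of sums of independent variables *)

Section bounded_random_variables.
Context d (T : measurableType d) (R : realType) (P : probability T R).
Implicit Types (f g : T -> R) (M : R).

Lemma bounded_fun_bounded f M : (forall w, `|f w| <= M) ->
  [bounded f w | w in [set: T]].
Proof.
move=> fM; exists M; split; first exact: num_real.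
by move=> x Mx w _ /=; rewrite (le_trans (fM w))// ltW.
Qed.

Lemma bounded_integrable f M : measurable_fun setT f -> (forall w, `|f w| <= M) ->
  P.-integrable setT (EFin \o f).
Proof.
move=> mf fM; apply: measurable_bounded_integrable => //.
- by rewrite (le_lt_trans (probability_le1 P measurableT))// ltry.
- exact: bounded_fun_bounded fM.
Qed.

Lemma integrable_mul_bounded f g M : P.-integrable setT (EFin \o f) ->
  measurable_fun setT g -> (forall w, `|g w| <= M) ->
  P.-integrable setT (fun w => (f w * g w)%:E).
Proof.
move=> fi mg gM.
apply: eq_integrable (integrableMl measurableT fi mg (bounded_fun_bounded gM)) => //.
Qed.

End bounded_random_variables.

Definition follows_law d (T : measurableType d) (R : realType)
    (P : probability T R) (Y : T -> R) (nu : set R -> \bar R) :=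
  forall A, measurable A -> P (Y @^-1` A) = nu A.

Section laws_of_sums.
Context d (T : measurableType d) (R : realType) (P : probability T R).
Implicit Types (U V : T -> R).

Definition RV_of (U : T -> R) (mU : measurable_fun setT U) : {RV P >-> R} :=
  HB.pack U (isMeasurableFun.Build _ _ _ _ U mU).

(** The law lives on the Borel sets generated by half-open intervals; [U'] is [U]
    seen as a map into the line with that generating family. *)
Lemma ge0_integral_law U (nu : {measure set (measurableTypeR R) -> \bar R})
    (g : R -> \bar R) :
  measurable_fun setT U -> follows_law P U nu ->
  measurable_fun setT g -> (forall x, 0 <= g x)%E ->
  (\int[P]_w g (U w) = \int[nu]_x g x)%E.
Proof.
move=> mU Unu mg g0; pose U' : T -> measurableTypeR R := U.
have mU' : measurable_fun setT U' by exact: mU.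
transitivity (\int[pushforward P U']_x g x)%E.
  by rewrite ge0_integral_pushforward.
by apply: eq_measure_integral => A mA _; exact: Unu.
Qed.

Lemma independent_funs_sum U V A (nu : set R -> \bar R) :
  measurable_fun setT U -> measurable_fun setT V ->
  independent_funs P U V -> follows_law P V nu -> measurable A ->
  P ((fun w => U w + V w) @^-1` A) =
  (\int[P]_w nu ((fun y => (U w + y)%R) @^-1` A))%E.
Proof.
move=> mU mV UV Vnu mA.
pose u := RV_of mU; pose v := RV_of mV.
pose X : set (R * R) := (fun p => p.1 + p.2) @^-1` A.
have mX : measurable X.
  by rewrite -[X]setTI; apply: measurable_funD.
transitivity (P ((fun w => (u w, v w)) @^-1` X)); first by [].
rewrite -(@independent_funs_joint_law _ _ _ P u v UV X mX) /product_measure1.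
rewrite ge0_integral_distribution//; last exact: measurable_fun_xsection.
apply: eq_integral => w _ /=.
rewrite /distribution/= /pushforward -Vnu; last first.
  by rewrite -[X in measurable X]setTI; apply: measurable_funD.
by congr (P _); apply/seteqP; split => w' /=; rewrite /xsection/= inE.
Qed.

Lemma follows_normal_scale U (c s : R) : c != 0 -> 0 < s ->
  follows_law P U (normal_prob 0 s) ->
  follows_law P (fun w => c * U w) (normal_prob 0 (`|c| * s)).
Proof.
move=> c0 s0 Us A mA; rewrite -normal_prob_affine// -Us.
  by congr (P _); apply/seteqP; split=> w /=; rewrite add0r.
exact: measurable_affine_preimage.
Qed.

Lemma follows_normal_sum U V (s t : R) : 0 < s -> 0 < t ->
  measurable_fun setT U -> measurable_fun setT V -> independent_funs P U V ->
  follows_law P U (normal_prob 0 s) -> follows_law P V (normal_prob 0 t) ->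
  follows_law P (fun w => U w + V w) (normal_prob 0 (Num.sqrt (s ^+ 2 + t ^+ 2))).
Proof.
move=> s0 t0 mU mV UV Us Vt A mA.
rewrite -(normal_prob_conv s0 t0 mA) (independent_funs_sum mU mV UV Vt mA).
transitivity (\int[P]_w normal_prob (U w) t A)%E; last first.
  apply: (@ge0_integral_law U (normal_prob 0 s) (fun x => normal_prob x t A)).
  - exact: mU.
  - exact: Us.
  - exact: measurable_normal_prob_mean.
  - by move=> x; exact: measure_ge0.
apply: eq_integral => w _.
have := normal_prob_affine (U w) (oner_neq0 R) t0 mA.
rewrite normr1 mul1r => <-; congr (normal_prob 0 t _).
by apply/seteqP; split=> y /=; rewrite mul1r.
Qed.

(** Given the value of [U], the sum hits [x] only if [V] hits one single point. *)
Lemma independent_funs_sum_atomless U V :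
  measurable_fun setT U -> measurable_fun setT V -> independent_funs P U V ->
  (forall x, P (V @^-1` [set x]) = 0%E) ->
  forall x, P ((fun w => U w + V w) @^-1` [set x]) = 0%E.
Proof.
move=> mU mV UV V0 x.
rewrite (@independent_funs_sum _ _ _ (distribution P (RV_of mV)))//.
apply: integral0_eq => w' _; rewrite /distribution /pushforward/= -[RHS](V0 (x - U w')).
congr (P _); apply/seteqP; split=> w /=.
  by move=> <-; rewrite addrAC subrr add0r.
by move=> ->; rewrite addrC subrK.
Qed.

Lemma Rintegral_law U V (g : R -> R) (nu : set R -> \bar R) M :
  measurable_fun setT U -> measurable_fun setT V ->
  follows_law P U nu -> follows_law P V nu ->
  measurable_fun setT g -> (forall x, `|g x| <= M) ->
  \int[P]_w g (U w) = \int[P]_w g (V w).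
Proof.
move=> mU mV Unu Vnu mg gM; rewrite /Rintegral; congr fine.
have h W (mW : measurable_fun setT W) :
    (\int[P]_w (g (W w))%:E = \int[distribution P (RV_of mW)]_x (g x)%:E)%E.
  rewrite integral_distribution//.
    exact/measurable_EFinP.
  apply: (@bounded_integrable _ _ _ _ (g \o W) M) => [|x]; last exact: gM.
  exact: measurableT_comp.
rewrite (h _ mU) (h _ mV); apply: eq_measure_integral => A mA _.
by transitivity (nu A); [exact: Unu|exact/esym/Vnu].
Qed.

Lemma independent_funs_Rintegral U V (f g : R -> R) M :
  measurable_fun setT U -> measurable_fun setT V -> independent_funs P U V ->
  measurable_fun setT f -> (forall x, `|f x| <= M) ->
  measurable_fun setT g -> (forall x, `|g x| <= M) ->
  \int[P]_w (f (U w) * g (V w)) = (\int[P]_w f (U w)) * (\int[P]_w g (V w)).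
Proof.
move=> mU mV UV mf fM mg gM.
pose u := RV_of mU; pose v := RV_of mV.
have mUV : measurable_fun setT (fun w => (U w, V w)).
  exact: measurable_fun_pair.
pose W : {RV P >-> (R * R)%type} :=
  HB.pack (fun w => (U w, V w)) (isMeasurableFun.Build _ _ _ _ _ mUV).
pose F (p : R * R) := f p.1 * g p.2.
have mF : measurable_fun setT F.
  by apply: measurable_funM; apply: measurableT_comp.
have FM p : `|F p| <= M * M by rewrite normrM ler_pM.
pose pq := (distribution P u \x distribution P v)%E.
have pq1 : (pq (setT `*` setT) = 1)%E.
  by rewrite /pq product_measure1E//= !probability_setT mule1.
have iF : pq.-integrable setT (EFin \o F).
  apply: measurable_bounded_integrable => //; last exact: bounded_fun_bounded FM.
  by change (pq setT < +oo)%E; rewrite -setXTT pq1 ltry.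
have gi : (distribution P v).-integrable setT (EFin \o g).
  exact: bounded_integrable gM.
have fi : (distribution P u).-integrable setT (EFin \o f).
  exact: bounded_integrable fM.
have gE : (\int[P]_w (g (V w))%:E = \int[distribution P v]_y (g y)%:E)%E.
  rewrite integral_distribution//; first exact/measurable_EFinP.
  apply: (@bounded_integrable _ _ _ _ (g \o V) M) => [|x]; last exact: gM.
  exact: measurableT_comp.
have fE : (\int[P]_w (f (U w))%:E = \int[distribution P u]_y (f y)%:E)%E.
  rewrite integral_distribution//; first exact/measurable_EFinP.
  apply: (@bounded_integrable _ _ _ _ (f \o U) M) => [|x]; last exact: fM.
  exact: measurableT_comp.
rewrite /Rintegral -fineM; last 2 first.
- by rewrite fE; exact: integrable_fin_num.
- by rewrite gE; exact: integrable_fin_num.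
congr fine; transitivity (\int[distribution P W]_p (EFin \o F) p)%E.
  apply/esym; apply: integral_distribution; first exact/measurable_EFinP.
  apply: (@bounded_integrable _ _ _ _ (F \o W) (M * M)) => [|x]; last exact: FM.
  exact: measurableT_comp.
transitivity (\int[pq]_p (EFin \o F) p)%E.
  apply: eq_measure_integral => A mA _.
  apply/esym; exact: (@independent_funs_joint_law _ _ _ P u v UV A mA).
rewrite -integral12_prod_meas1// /fubini_F/= gE fE.
have gfin : (\int[distribution P v]_y (g y)%:E)%E \is a fin_num.
  exact: integrable_fin_num.
transitivity (\int[distribution P u]_x ((f x)%:E * \int[distribution P v]_y (g y)%:E))%E.
  by apply: eq_integral => x _; rewrite -integralZl.
by rewrite -(fineK gfin) integralZr.
Qed.

End laws_of_sums.

(** * Gaussian noise *)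

Section gaussian_noise.
Context d (T : measurableType d) (R : realType) (P : probability T R).
Variables (Z : nat -> {RV P >-> R}) (sigma : R).
Hypotheses (sigma0 : 0 < sigma) (Z_indep : mutually_independent Z).
Hypothesis Z_law : forall k, follows_law P (Z k) (normal_prob 0 sigma).
Implicit Types (c : nat -> R) (I J : set nat).

Lemma measurable_wrt_coord I k : I k -> measurable_wrt <<s cylinders Z I >> (Z k).
Proof. by move=> Ik B mB; apply: sub_sigma_algebra; exact: cylinders_coord. Qed.

Lemma measurable_wrt_block I p m c : (forall k, (k < m)%N -> I (p + k)%N) ->
  measurable_wrt <<s cylinders Z I >>
    (fun w => \sum_(k < m) c k * Z (p + k)%N w).
Proof.
move=> pI; apply/measurable_wrtP.
elim: m pI => [|m IH] pI.
  by under eq_fun do rewrite big_ord0; exact: measurable_cst.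
under eq_fun do rewrite big_ord_recr/=.
apply: measurable_funD; first by apply: IH => k km; apply: pI; exact: ltnW.
apply: measurable_funM; first exact: measurable_cst.
apply/measurable_wrtP; exact: (measurable_wrt_coord (pI _ (ltnSn m))).
Qed.

Lemma sigma_cylinders_measurable I : <<s cylinders Z I >> `<=` measurable.
Proof.
apply: smallest_sub; first exact: sigma_algebra_measurable.
exact: cylinders_measurable.
Qed.

Lemma measurable_block p m c :
  measurable_fun setT (fun w => \sum_(k < m) c k * Z (p + k)%N w).
Proof.
apply: (measurable_wrt_measurable (@sigma_cylinders_measurable setT)).
exact: measurable_wrt_block.
Qed.

Lemma independent_blocks p m c q l (e : nat -> R) : (p + m <= q)%N ->
  independent_funs P (fun w => \sum_(k < m) c k * Z (p + k)%N w)
                     (fun w => \sum_(k < l) e k * Z (q + k)%N w).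
Proof.
move=> pmq; apply: (@independent_sigma_funs _ _ _ _
  <<s cylinders Z [set k | (k < q)%N] >> <<s cylinders Z [set k | (q <= k)%N] >>).
- apply: independent_disjoint_blocks => //; apply/seteqP; split=> // k [/= kq qk].
  by move: (leq_trans kq qk); rewrite ltnn.
- apply: measurable_wrt_block => k km /=.
  by rewrite (leq_trans _ pmq)// ltn_add2l.
- by apply: measurable_wrt_block => k km /=; exact: leq_addr.
Qed.

Lemma follows_normal_block p m c : (forall k, (k <= m)%N -> c k != 0) ->
  follows_law P (fun w => \sum_(k < m.+1) c k * Z (p + k)%N w)
    (normal_prob 0 (Num.sqrt (\sum_(k < m.+1) c k ^+ 2) * sigma)).
Proof.
elim: m => [|m IH] c0.
  under eq_fun do rewrite big_ord1; rewrite big_ord1 sqrtr_sqr.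
  by apply: follows_normal_scale => //; exact: c0.
have S0 n : (n <= m.+1)%N -> 0 < \sum_(k < n.+1) c k ^+ 2.
  move=> nm; rewrite big_ord_recr/= ltr_wpDl//.
    by apply: sumr_ge0 => k _; exact: sqr_ge0.
  by rewrite exprn_even_gt0//=; exact: c0.
under eq_fun do rewrite big_ord_recr/=.
have -> : Num.sqrt (\sum_(k < m.+2) c k ^+ 2) * sigma =
    Num.sqrt ((Num.sqrt (\sum_(k < m.+1) c k ^+ 2) * sigma) ^+ 2 +
              (`|c m.+1| * sigma) ^+ 2).
  have -> : (Num.sqrt (\sum_(k < m.+1) c k ^+ 2) * sigma) ^+ 2 +
      (`|c m.+1| * sigma) ^+ 2 = (\sum_(k < m.+2) c k ^+ 2) * sigma ^+ 2.
    rewrite !exprMn sqr_sqrtr; last by rewrite ltW// S0.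
    by rewrite real_normK ?num_real// -mulrDl [in RHS]big_ord_recr.
  by rewrite sqrtrM ?ltW ?S0// sqrtr_sqr gtr0_norm.
apply: follows_normal_sum.
- by rewrite mulr_gt0// sqrtr_gt0 S0.
- by rewrite mulr_gt0// normr_gt0 c0.
- exact: measurable_block.
- by apply: measurable_funM => //; exact: measurable_funP.
- have := @independent_blocks p m.+1 c (p + m.+1)%N 1%N
    (fun k => c (m.+1 + k)%N) (leqnn _).
  by move=> + A B mA mB => /(_ A B mA mB); under [X in (X @^-1` B)]eq_fun do
    rewrite big_ord1 !addn0.
- by apply: IH => k km; apply: c0; exact: leqW.
- by apply: follows_normal_scale => //; exact: c0.
Qed.

Lemma atomless_normal (U : T -> R) s : follows_law P U (normal_prob 0 s) ->
  forall x, P (U @^-1` [set x]) = 0%E.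
Proof.
by move=> Us x; rewrite Us; [rewrite /normal_prob integral_set1|].
Qed.

(** Half of the quadratic exponent is spent on [|x|], by [1 + y <= exp y] and
    [|x| <= sigma + x ^ 2 / (4 sigma)]; the other half is again Gaussian. *)
Lemma normal_fun_abs_le (x : R) :
  `|x| * normal_fun 0 sigma x <= sigma * normal_fun 0 (Num.sqrt 2 * sigma) x.
Proof.
pose y := x ^+ 2 / (sigma ^+ 2 * 4).
have -> : normal_fun 0 (Num.sqrt 2 * sigma) x = expR (- y).
  rewrite /normal_fun; congr expR; rewrite /y exprMn sqr_sqrtr//.
  by field; rewrite gt_eqF.
have -> : normal_fun 0 sigma x = expR (- y) * expR (- y).
  by rewrite /normal_fun -expRD; congr expR; rewrite /y; field; rewrite gt_eqF.
rewrite mulrA ler_wpM2r ?expR_ge0// expRN ler_pdivrMr ?expR_gt0//.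
apply: (@le_trans _ _ (sigma * (1 + y))); last first.
  by rewrite ler_pM2l// expR_ge1Dx.
have -> : sigma * (1 + y) = `|x| + (`|x| / 2 - sigma) ^+ 2 / sigma.
  have -> : y = `|x| ^+ 2 / (sigma ^+ 2 * 4) by rewrite real_normK ?num_real.
  by field; rewrite gt_eqF.
by rewrite lerDl divr_ge0 ?sqr_ge0// ltW.
Qed.

Lemma normal_abs_integral_lty :
  (\int[normal_prob 0 sigma]_x `|x|%:E < +oo)%E.
Proof.
rewrite ge0_integral_normal_prob//; last first.
  by apply/measurable_EFinP; exact: normr_measurable.
pose s' := Num.sqrt 2 * sigma.
have s'0 : 0 < s' by rewrite mulr_gt0// sqrtr_gt0.
have p'0 : 0 < normal_peak s' by rewrite normal_peak_gt0// gt_eqF.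
pose K := sigma * (normal_peak sigma / normal_peak s').
have K0 : 0 <= K.
  by rewrite mulr_ge0 ?(ltW sigma0)// divr_ge0// normal_peak_ge0.
apply: (@le_lt_trans _ _ (\int[lebesgue_measure]_x (K%:E * (normal_pdf 0 s' x)%:E))%E).
  apply: ge0_le_integral => //.
  - by move=> x _; rewrite -EFinM lee_fin mulr_ge0// normal_pdf_ge0.
  - apply: emeasurable_funM; apply/measurable_EFinP; first exact: normr_measurable.
    exact: measurable_normal_pdf.
  - apply: emeasurable_funM => //; apply/measurable_EFinP.
    exact: measurable_normal_pdf.
  move=> x _; rewrite -!EFinM lee_fin !normal_pdfE ?gt_eqF//.
  have -> : K * (normal_peak s' * normal_fun 0 s' x) =
            normal_peak sigma * (sigma * normal_fun 0 s' x).
    by rewrite /K; field; rewrite gt_eqF.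
  by rewrite mulrCA ler_wpM2l ?normal_peak_ge0// normal_fun_abs_le.
rewrite ge0_integralZl//; last 2 first.
- by apply/measurable_EFinP; exact: measurable_normal_pdf.
- by move=> x _; rewrite lee_fin normal_pdf_ge0.
by rewrite integral_normal_pdf mule1 ltry.
Qed.

(** Borel-Cantelli in integrated form: the weighted sum of the absolute values
    has finite expectation, hence is finite almost surely, and its terms are
    bounded by it. *)
Lemma noise_geo_bounded (rho : R) : 1 < rho ->
  {ae P, forall w, geo_bounded rho (fun k => Z k w)}.
Proof.
move=> rho1; have rho0 : 0 < rho by rewrite (lt_trans _ rho1).
pose f k (w : T) : \bar R := (rho^-1 ^+ k * `|Z k w|)%:E.
have f0 k w : (0 <= f k w)%E.
  by rewrite lee_fin mulr_ge0// exprn_ge0// invr_ge0 ltW.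
have mf k : measurable_fun setT (f k).
  apply/measurable_EFinP; apply: measurable_funM => //.
  by apply: measurableT_comp => //; exact: measurable_funP.
set K := (\int[normal_prob 0 sigma]_x `|x|%:E)%E.
have K0 : (0 <= K)%E by apply: integral_ge0.
have Kfin : K \is a fin_num by rewrite ge0_fin_numE// normal_abs_integral_lty.
have fE k : (\int[P]_w f k w = (rho^-1 ^+ k * fine K)%:E)%E.
  rewrite /f; under eq_integral do rewrite EFinM.
  rewrite ge0_integralZl//; last 2 first.
  - apply/measurable_EFinP; apply: measurableT_comp => //; exact: measurable_funP.
  - by rewrite lee_fin exprn_ge0// invr_ge0 ltW.
  rewrite EFinM fineK//; congr (_ * _)%E.
  apply: (@ge0_integral_law _ _ _ _ (Z k) (normal_prob 0 sigma) (fun x => `|x|%:E)).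
  - exact: measurable_funP.
  - exact: Z_law.
  - by apply/measurable_EFinP; exact: normr_measurable.
  - by [].
have r1 : rho^-1 < 1 by rewrite invf_lt1.
have If : P.-integrable setT (fun w => \sum_(k <oo) f k w)%E.
  apply/integrableP; split.
    by apply: ge0_emeasurable_sum => // k w _ _; exact: f0.
  under eq_integral do rewrite gee0_abs ?nneseries_ge0//.
  rewrite integral_nneseries//.
  apply: (@le_lt_trans _ _ (fine K / (1 - rho^-1))%:E); last exact: ltry.
  apply: lime_le; first by apply: is_cvg_nneseries => k _ _; exact: integral_ge0.
  apply: nearW => n; under eq_bigr do rewrite fE.
  rewrite sumEFin lee_fin -mulr_suml mulrC ler_wpM2l ?fine_ge0//.
  rewrite -[leRHS]mul1r ler_pdivlMr ?subr_gt0// mulrC big_mkord.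
  have -> : (1 - rho^-1) * (\sum_(k < n) rho^-1 ^+ k) = 1 - rho^-1 ^+ n.
    by rewrite -[RHS]opprB subrX1; ring.
  by rewrite gerBl exprn_ge0// invr_ge0 ltW.
have := integrable_ae measurableT If.
apply: filterS => w /(_ Logic.I) fw.
exists (fine (\sum_(k <oo) f k w)); first by rewrite fine_ge0// nneseries_ge0.
move=> n; rewrite -ler_pdivrMr ?exprn_gt0//.
rewrite -lee_fin fineK//.
have fn : (f n w <= \sum_(k <oo) f k w)%E.
  apply: le_trans (nneseries_lim_ge n.+1 _); last by move=> k _ _; exact: f0.
  by rewrite big_nat_recr//= leeDr// sume_ge0.
by apply: le_trans fn; rewrite /f lee_fin exprVn mulrC.
Qed.

End gaussian_noise.

Section gaussian_blocks.
Context d (T : measurableType d) (R : realType) (P : probability T R).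
Variables (Z : nat -> {RV P >-> R}) (sigma lam : R).
Hypotheses (sigma0 : 0 < sigma) (Z_indep : mutually_independent Z).
Hypothesis Z_law : forall k, follows_law P (Z k) (normal_prob 0 sigma).
Hypothesis lam0 : lam != 0.
Local Notation N := (fun n w => block_sum lam (fun k => Z k w) n).

Lemma measurable_block_sum n : measurable_fun setT (N n).
Proof. exact: (measurable_block Z (n - n./2) n./2 (block_coef lam n)). Qed.

Lemma follows_normal_block_sum n : (2 <= n)%N ->
  follows_law P (N n) (normal_prob 0 sigma).
Proof.
move=> n2; have [m0 _ _] := half_split n2.
have := follows_normal_block sigma0 Z_indep Z_law (n - n./2) (m := n./2.-1)
  (c := block_coef lam n) (fun k _ => block_coef_neq0 k lam0 n2).
rewrite (prednK m0) (sum_block_coef_sqr lam0 n2) sqrtr1 mul1r; exact.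
Qed.

Lemma independent_block_sums n m : (2 <= n)%N -> (n.*2 <= m)%N ->
  independent_funs P (N n) (N m).
Proof.
move=> n2 nm; apply: independent_blocks => //.
have [_ <- _] := half_split n2.
by rewrite leq_psubRL ?(leq_trans _ n2)//; lia.
Qed.

End gaussian_blocks.

(** * The limit of the explosive component *)

Section limit_of_the_explosive_component.
Context d (T : measurableType d) (R : realType) (P : probability T R).
Variables (Z X : nat -> {RV P >-> R}) (sigma lam mu : R).
Hypotheses (sigma0 : 0 < sigma) (Z_indep : mutually_independent Z).
Hypothesis Z_law : forall k, follows_law P (Z k) (normal_prob 0 sigma).
Hypothesis init_indep : independent_sigma P
  (g_sigma_preimageU (X 1%N) (X 0%N)) (sigma_seq Z).
Hypothesis lam0 : lam != 0.
Hypothesis X_rec : forall k w,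
  X k.+2 w = (lam + mu) * X k.+1 w - lam * mu * X k w + Z k w.
Local Notation i := (lam^-1).

(** A limit superior, so that the function is measurable everywhere, including
    on the null set where the series diverges. *)
Definition discounted_tail (w : T) : R :=
  fine (limn_esup (fun n => (\sum_(k < n) i ^+ k.+2 * Z (1 + k)%N w)%:E)).

(** The limit of [lam ^- n * (X_n - mu X_{n-1})], with the first innovation set
    apart because its law is what rules out atoms. *)
Definition explosive_limit (w : T) : R :=
  (X 1%N w - mu * X 0%N w) + (discounted_tail w + i * Z 0%N w).

Lemma measurable_wrt_discounted_tail :
  measurable_wrt <<s cylinders Z [set k | (0 < k)%N] >> discounted_tail.
Proof.
apply/measurable_wrtP; apply: measurableT_comp => //.
apply: measurable_fun_limn_esup => n; apply/measurable_EFinP.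
apply/measurable_wrtP.
exact: (@measurable_wrt_block _ _ _ P Z [set k | (0 < k)%N] 1 n (fun k => i ^+ k.+2)).
Qed.

Lemma measurable_wrt_noise_part :
  measurable_wrt (sigma_seq Z) (fun w => discounted_tail w + i * Z 0%N w).
Proof.
apply: (measurable_wrt_sub (@sub_sigma_seq _ _ _ _ Z setT)).
apply/measurable_wrtP; apply: measurable_funD.
  apply/measurable_wrtP; apply: measurable_wrt_sub measurable_wrt_discounted_tail.
  by apply: sub_sigma_algebra2; exact: sub_cylinders.
apply: measurable_funM; first exact: measurable_cst.
apply/measurable_wrtP; exact: measurable_wrt_coord.
Qed.

Lemma measurable_wrt_init_part : measurable_wrt
  (g_sigma_preimageU (X 1%N) (X 0%N)) (fun w => X 1%N w - mu * X 0%N w).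
Proof.
apply/measurable_wrtP; apply: measurable_funB.
  apply/measurable_wrtP => B mB; apply: sub_sigma_algebra; left.
  by exists B => //; rewrite setTI.
apply: measurable_funM; first exact: measurable_cst.
apply/measurable_wrtP => B mB; apply: sub_sigma_algebra; right.
by exists B => //; rewrite setTI.
Qed.

Lemma measurable_noise_part :
  measurable_fun setT (fun w => discounted_tail w + i * Z 0%N w).
Proof.
apply: measurable_funD.
  apply: measurable_wrt_measurable measurable_wrt_discounted_tail.
  exact: sigma_cylinders_measurable.
by apply: measurable_funM => //; exact: measurable_funP.
Qed.

Lemma measurable_init_part :
  measurable_fun setT (fun w => X 1%N w - mu * X 0%N w).
Proof.
apply: measurable_funB; first exact: measurable_funP.
by apply: measurable_funM => //; exact: measurable_funP.
Qed.

Lemma measurable_explosive_limit : measurable_fun setT explosive_limit.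
Proof. exact: (measurable_funD measurable_init_part measurable_noise_part). Qed.

(** The summand [i * Z 0] is Gaussian, hence atomless, and independent of the
    later innovations; their sum is independent of the initial values. *)
Lemma explosive_limit_neq0 : P (explosive_limit @^-1` [set 0]) = 0%E.
Proof.
have i0 : i != 0 by rewrite invr_eq0.
apply: (independent_funs_sum_atomless measurable_init_part measurable_noise_part).
  apply: independent_sigma_funs init_indep _ _.
    exact: measurable_wrt_init_part.
  exact: measurable_wrt_noise_part.
have miZ : measurable_fun setT (fun w => i * Z 0%N w).
  by apply: measurable_funM => //; exact: measurable_funP.
apply: (independent_funs_sum_atomless _ miZ).
- apply: measurable_wrt_measurable measurable_wrt_discounted_tail.
  exact: sigma_cylinders_measurable.
- apply: (@independent_sigma_funs _ _ _ _
    <<s cylinders Z [set k | (0 < k)%N] >> <<s cylinders Z [set 0%N] >>).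
  + apply: independent_disjoint_blocks => //.
    by apply/seteqP; split=> // k [/= k0 k0']; rewrite k0' in k0.
  + exact: measurable_wrt_discounted_tail.
  + apply/measurable_wrtP; apply: measurable_funM; first exact: measurable_cst.
    apply/measurable_wrtP; exact: measurable_wrt_coord.
- apply: (@atomless_normal _ _ _ _ _ (`|i| * sigma)).
  exact: follows_normal_scale.
Qed.

Lemma explosive_limitP w (y : R) :
  i ^+ n * (X n.+1 w - mu * X n w) @[n --> \oo] --> y -> y = explosive_limit w.
Proof.
move=> Yy; pose Y n := i ^+ n * (X n.+1 w - mu * X n w).
have YE n : Y n = Y 0%N + \sum_(k < n) i ^+ k.+1 * Z k w.
  elim: n => [|n IH]; first by rewrite big_ord0 addr0.
  rewrite big_ord_recr/= addrA -IH /Y X_rec !exprS; field.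
  exact: lam0.
have Ysc : Y n.+1 @[n --> \oo] --> y by rewrite (cvg_shiftS Y).
have Sc : \sum_(k < n) i ^+ k.+2 * Z (1 + k)%N w @[n --> \oo] -->
    y - (Y 0%N + i * Z 0%N w).
  have -> : (fun n => \sum_(k < n) i ^+ k.+2 * Z (1 + k)%N w) =
            (fun n => Y n.+1 - (Y 0%N + i * Z 0%N w)).
    by apply/funext => n; rewrite YE big_ord_recl/= expr1 addrA [RHS]addrC addKr.
  by apply: cvgB => //; exact: cvg_cst.
have tE : discounted_tail w = y - (Y 0%N + i * Z 0%N w).
  rewrite /discounted_tail (cvg_limn_einf_sup (l := (y - (Y 0%N + i * Z 0%N w))%:E))//.
  by apply/cvg_EFin; first exact: nearW.
by rewrite /explosive_limit tE /Y expr0 mul1r; ring.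
Qed.

End limit_of_the_explosive_component.

(** * Mixing from sparse independence *)

Section dominated_convergence_in_R.
Context d (T : measurableType d) (R : realType) (P : probability T R).

Lemma Rintegral_dominated_cvg0 (F : nat -> T -> R) (h : T -> R) :
  (forall n, measurable_fun setT (F n)) ->
  {ae P, forall w, F n w @[n --> \oo] --> 0} ->
  P.-integrable setT (EFin \o h) ->
  (forall n w, `|F n w| <= h w) ->
  \int[P]_w F n w @[n --> \oo] --> 0.
Proof.
move=> mF F0 ih Fh.
have [] := @dominated_convergence _ _ _ P setT measurableT
  (fun n w => (F n w)%:E) (cst 0%E) (EFin \o h).
- by move=> n; exact/measurable_EFinP.
- exact: measurable_cst.
- apply: filterS F0 => w Fw _.
  by apply/cvg_EFin => //; exact: nearW.
- exact: ih.
- by apply: aeW => w n _; rewrite /= lee_fin.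
move=> _ _; rewrite integral_cst// mul0e => h0.
exact: (fine_cvg h0).
Qed.

End dominated_convergence_in_R.

Definition bounded_measurable d (T : measurableType d) (R : realType)
    (f : T -> R) : Prop :=
  measurable_fun setT f /\ exists M, forall w, `|f w| <= M.

Section bounded_measurable.
Context d (T : measurableType d) (R : realType) (P : probability T R).
Implicit Types f g : T -> R.

Lemma bounded_measurable_integrable f : bounded_measurable f ->
  P.-integrable setT (EFin \o f).
Proof. by move=> [mf [M fM]]; exact: bounded_integrable fM. Qed.

Lemma bounded_measurableD f g : bounded_measurable f -> bounded_measurable g ->
  bounded_measurable (fun w => f w + g w).
Proof.
move=> [mf [M fM]] [mg [N gN]]; split; first exact: measurable_funD.
by exists (M + N) => w; rewrite (le_trans (ler_normD _ _))// lerD.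
Qed.

Lemma bounded_measurableM f g : bounded_measurable f -> bounded_measurable g ->
  bounded_measurable (fun w => f w * g w).
Proof.
move=> [mf [M fM]] [mg [N gN]]; split; first exact: measurable_funM.
by exists (M * N) => w; rewrite normrM ler_pM.
Qed.

Lemma bounded_measurable_cst (a : R) : bounded_measurable (fun _ : T => a).
Proof. by split; [exact: measurable_cst|exists `|a|]. Qed.

Lemma bounded_measurable_comp (f : T -> R) (g : R -> R) :
  measurable_fun setT f -> bounded_measurable g ->
  bounded_measurable (fun w => g (f w)).
Proof.
move=> mf [mg [M gM]]; split; first exact: measurableT_comp.
by exists M => w; exact: gM.
Qed.

Lemma Rintegral_lincomb (a : R) f g :
  P.-integrable setT (EFin \o f) -> P.-integrable setT (EFin \o g) ->
  \int[P]_w (f w + a * g w) = \int[P]_w f w + a * \int[P]_w g w.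
Proof.
move=> fi gi; rewrite RintegralD//; first by rewrite RintegralZl.
by apply: eq_integrable (integrableZl measurableT a gi).
Qed.

End bounded_measurable.

(** Independence is assumed only between [N n] and [N m] with [m] at least twice
    [n]; this is what disjoint blocks of innovations provide. *)
Section sparse_independence_is_mixing.
Context d (T : measurableType d) (R : realType) (P : probability T R).
Variables (N : nat -> T -> R) (g : R -> R) (c : R).
Hypothesis mN : forall n, measurable_fun setT (N n).
Hypothesis N_indep : forall n m, (2 <= n)%N -> (n.*2 <= m)%N ->
  independent_funs P (N n) (N m).
Hypothesis g_bm : bounded_measurable g.
Hypothesis N_mean : forall n, (2 <= n)%N -> \int[P]_w g (N n w) = c.

Let U n w := g (N n w) - c.

Let U_bm n : bounded_measurable (U n).
Proof.
apply: bounded_measurableD; first exact: bounded_measurable_comp.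
exact: bounded_measurable_cst.
Qed.

Let U_orth n m : (2 <= n)%N -> (n.*2 <= m)%N -> \int[P]_w (U n w * U m w) = 0.
Proof.
move=> n2 nm; have [mg [M gM]] := g_bm.
have mU : measurable_fun setT (fun x => g x - c) by exact: measurable_funB.
have UM x : `|g x - c| <= M + `|c|.
  by rewrite (le_trans (ler_normB _ _))// lerD2r.
have U0 k : (2 <= k)%N -> \int[P]_w (g (N k w) - c) = 0.
  move=> k2; rewrite RintegralB//; last 2 first.
  - by apply: bounded_measurable_integrable; exact: bounded_measurable_comp.
  - by apply: bounded_measurable_integrable; exact: bounded_measurable_cst.
  rewrite N_mean// Rintegral_cst// [X in fine X]probability_setT mulr1 subrr//.
rewrite (@independent_funs_Rintegral _ _ _ _ _ _ (fun x => g x - c)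
  (fun x => g x - c) (M + `|c|))//; last exact: N_indep.
by rewrite U0// mul0r.
Qed.

(** Bessel's inequality along a sparse subsequence.  If the correlation of
    [xi] with [U n] stayed above [e] for arbitrarily large [n], the indices
    could be chosen to double each time, which makes the chosen [U n] mutually
    orthogonal; subtracting from [xi] a fixed small multiple of each of them in
    turn would lower the mean square by a fixed amount every time. *)
Lemma correlation_cvg0_bounded (xi : T -> R) : bounded_measurable xi ->
  \int[P]_w (xi w * U n w) @[n --> \oo] --> 0.
Proof.
move=> xi_bm; apply: contrapT => ncvg.
have [e e0 He] : exists2 e, 0 < e &
    forall k, exists2 n, (k <= n)%N & e <= `|\int[P]_w (xi w * U n w)|.
  apply: contrapT => nH; apply: ncvg; apply/cvgr0Pnorm_lt => e e0.
  apply: contrapT => nnear; apply: nH; exists e => // k.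
  apply: contrapT => nk; apply: nnear; exists k => // n /= kn.
  rewrite ltNge; apply/negP => en; apply: nk; exists n => //.
have [f fk fe] : exists2 f : nat -> nat, (forall k, (k <= f k)%N) &
    forall k, e <= `|\int[P]_w (xi w * U (f k) w)|.
  have h k : {n | (k <= n)%N /\ e <= `|\int[P]_w (xi w * U n w)|}.
    by apply: cid; have [n] := He k; exists n.
  exists (fun k => sval (h k)) => k; by case: (svalP (h k)).
pose nn := fix nn k := if k is k'.+1 then f (nn k').*2 else f 2%N.
have nn2 k : (2 <= nn k)%N.
  elim: k => [|k IH]; first exact: fk.
  by rewrite (leq_trans _ (fk _))// (leq_trans IH)// -addnn leq_addr.
have nnS j k : (j < k)%N -> ((nn j).*2 <= nn k)%N.
  elim: k => // k IH; rewrite ltnS leq_eqVlt => /predU1P[->|jk]; first exact: fk.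
  by rewrite (leq_trans (IH jk))// (leq_trans _ (fk _))// -addnn leq_addr.
have nne k : e <= `|\int[P]_w (xi w * U (nn k) w)|.
  by case: k => [|k]; exact: fe.
have [mg [M gM]] := g_bm.
pose B := (M + `|c|) ^+ 2 + 1.
have B0 : 0 < B by rewrite ltr_wpDl// sqr_ge0.
have UB n w : (U n w) * (U n w) <= B.
  rewrite /B -expr2 -real_normK ?num_real// (@le_trans _ _ ((M + `|c|) ^+ 2))//.
    rewrite ler_sqr ?nnegrE//; last by rewrite (le_trans _ (lerD (gM 0) (lexx _))) ?addr_ge0.
    by rewrite (le_trans (ler_normB _ _))// lerD2r.
  by rewrite lerDl.
(* this [t] balances the gain [2 * t * e] of one step against its cost [t ^+ 2 * B] *)
pose t := e / B.
have t0 : 0 < t by rewrite divr_gt0.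
pose s k := Num.sg (\int[P]_w (xi w * U (nn k) w)).
pose r := fix r k : T -> R :=
  if k is k'.+1 then fun w => r k' w + (- (t * s k')) * U (nn k') w else xi.
have r_bm k : bounded_measurable (r k).
  elim: k => [//|k IH]; apply: bounded_measurableD => //.
  by apply: bounded_measurableM => //; exact: bounded_measurable_cst.
have bmi h : bounded_measurable h -> P.-integrable setT (EFin \o h).
  exact: bounded_measurable_integrable.
have rU k j : (k <= j)%N ->
    \int[P]_w (r k w * U (nn j) w) = \int[P]_w (xi w * U (nn j) w).
  elim: k => [//|k IH] kj; rewrite -IH; last exact: ltnW.
  have -> : \int[P]_w (r k.+1 w * U (nn j) w) = \int[P]_w (r k w * U (nn j) w +
      (- (t * s k)) * (U (nn k) w * U (nn j) w)).
    by apply: eq_Rintegral => w _ /=; ring.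
  rewrite Rintegral_lincomb; [|exact/bmi/bounded_measurableM..].
  by rewrite U_orth ?mulr0 ?addr0// nnS.
have rr k : \int[P]_w (r k w * r k w) <= \int[P]_w (xi w * xi w) - k%:R * (t * e).
  elim: k => [|k IH]; first by rewrite mul0r subr0.
  have -> : \int[P]_w (r k.+1 w * r k.+1 w) = \int[P]_w ((r k w * r k w +
      (- (2 * t * s k)) * (r k w * U (nn k) w)) +
      (t * s k) ^+ 2 * (U (nn k) w * U (nn k) w)).
    by apply: eq_Rintegral => w _ /=; ring.
  rewrite Rintegral_lincomb; last 2 first.
  - apply/bmi/bounded_measurableD; first exact: bounded_measurableM.
    apply: bounded_measurableM; first exact: bounded_measurable_cst.
    exact: bounded_measurableM.
  - exact/bmi/bounded_measurableM.
  rewrite Rintegral_lincomb; [|exact/bmi/bounded_measurableM..].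
  rewrite rU//; set q := \int[P]_w (xi w * U (nn k) w).
  have qe : t * e <= t * (s k * q).
    by rewrite ler_pM2l// /s -/q -normrEsg; exact: nne.
  have UUB : \int[P]_w (U (nn k) w * U (nn k) w) <= B.
    apply: (@le_trans _ _ (\int[P]_w B)).
      apply: le_Rintegral => //; first exact/bmi/bounded_measurableM.
      exact/bmi/bounded_measurable_cst.
    by rewrite Rintegral_cst// [X in fine X]probability_setT mulr1.
  have UU0 : 0 <= \int[P]_w (U (nn k) w * U (nn k) w).
    by apply: Rintegral_ge0 => w _; rewrite -expr2 sqr_ge0.
  have s2 : (s k) ^+ 2 <= 1 by rewrite /s sqr_sg; case: (_ != 0).
  have tB : t ^+ 2 * B = t * e by rewrite /t; field; rewrite gt_eqF.
  have last : (t * s k) ^+ 2 * \int[P]_w (U (nn k) w * U (nn k) w) <= t * e.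
    rewrite -tB exprMn; apply: ler_pM => //; first by rewrite mulr_ge0 ?sqr_ge0.
    by rewrite ler_piMr// sqr_ge0.
  have -> : - (2 * t * s k) * q = - (2 * (t * (s k * q))) by ring.
  by rewrite -natr1 mulrDl mul1r; lra.
have te0 : 0 < t * e by rewrite mulr_gt0.
have [k kb] : exists k, \int[P]_w (xi w * xi w) < k%:R * (t * e).
  exists (Num.bound `|\int[P]_w (xi w * xi w) / (t * e)|).
  rewrite -ltr_pdivrMr// (le_lt_trans (ler_norm _))//.
  by rewrite archi_boundP.
have : 0 <= \int[P]_w (r k w * r k w).
  by apply: Rintegral_ge0 => w _; rewrite -expr2 sqr_ge0.
by have := rr k; lra.
Qed.

(** Truncate [xi]: the error is small in mean uniformly in [n], because [g] is
    bounded. *)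
Lemma correlation_cvg0 (xi : T -> R) : P.-integrable setT (EFin \o xi) ->
  \int[P]_w (xi w * U n w) @[n --> \oo] --> 0.
Proof.
move=> xi_i; have mxi : measurable_fun setT xi.
  by apply/measurable_EFinP; exact: measurable_int xi_i.
pose A a := [set w | `|xi w| <= a%:R].
have mA a : measurable (A a).
  rewrite -[A a]setTI; apply: measurable_fun_ler => //.
  exact: measurableT_comp.
pose xa a w := xi w * \1_(A a) w.
have xa_bm a : bounded_measurable (xa a).
  split; first by apply: measurable_funM => //; exact: measurable_indic.
  exists a%:R => w; rewrite /xa indicE; have [wA|_] := boolP (w \in A a).
    by rewrite mulr1; move: wA; rewrite inE.
  by rewrite mulr0 normr0.
have [mg [M gM]] := g_bm.
have UM n w : `|U n w| <= M + `|c|.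
  by rewrite (le_trans (ler_normB _ _))// lerD2r.
have M0 : 0 <= M + `|c| by rewrite (le_trans _ (UM 0%N point)).
have tail : \int[P]_w `|xi w - xa a w| @[a --> \oo] --> 0.
  apply: (@Rintegral_dominated_cvg0 _ _ _ _ _ (fun w => `|xi w|)).
  - move=> a; apply: measurableT_comp => //; apply: measurable_funB => //.
    by case: (xa_bm a).
  - apply: aeW => w.
    apply: cvg_near_cst; exists (Num.bound `|xi w|) => // a /= wa.
    rewrite /xa indicE mem_set ?mulr1 ?subrr ?normr0//=.
    by rewrite /A /= (le_trans (ltW (archi_boundP (normr_ge0 (xi w)))))// ler_nat.
  - exact: integrable_norm.
  - move=> a w; rewrite normr_id /xa indicE; case: (w \in _).
      by rewrite mulr1 subrr normr0.
    by rewrite mulr0 subr0.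
have xi_U n (h : T -> R) : P.-integrable setT (EFin \o h) ->
    P.-integrable setT (EFin \o (fun w => h w * U n w)).
  move=> ih; apply: integrable_mul_bounded (UM n) => //.
  by case: (U_bm n).
apply/cvgr0Pnorm_lt => e e0.
have [a ae] : exists a, \int[P]_w `|xi w - xa a w| * (M + `|c|) < e / 2.
  have h : \int[P]_w `|xi w - xa a w| * (M + `|c|) @[a --> \oo] --> 0.
    by rewrite -[X in _ --> X](mul0r (M + `|c|)); apply: cvgM => //; exact: cvg_cst.
  have e2 : 0 < e / 2 by rewrite divr_gt0.
  have [a _ Ha] := cvgr_lt _ h _ e2.
  by exists a; apply: Ha => /=.
have /cvgr0Pnorm_lt/(_ (e / 2)) := correlation_cvg0_bounded (xa_bm a).
rewrite divr_gt0// => /(_ isT); apply: filterS => n hn.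
have id : P.-integrable setT (EFin \o (fun w => xi w - xa a w)).
  apply: eq_integrable (integrableB measurableT xi_i
    (bounded_measurable_integrable P (xa_bm a))) => //.
have -> : \int[P]_w (xi w * U n w) = \int[P]_w (xa a w * U n w +
    1 * ((xi w - xa a w) * U n w)).
  by apply: eq_Rintegral => w _; ring.
rewrite Rintegral_lincomb; last 2 first.
- by apply: xi_U; exact: bounded_measurable_integrable.
- exact: xi_U.
rewrite mul1r (le_lt_trans (ler_normD _ _))// [e]splitr; apply: ltrD => //.
apply: le_lt_trans ae; rewrite (le_trans (le_normr_Rintegral _ (xi_U n _ id)))//.
rewrite -RintegralZr//; last exact: integrable_norm.
apply: le_Rintegral => //.
- exact: (integrable_norm (xi_U n _ id)).
- apply: eq_integrable (integrableZr measurableT (M + `|c|) (integrable_norm id)) => //.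
- by move=> w _; rewrite normrM ler_wpM2l.
Qed.

Lemma mixing_cvg_expectation (xi : T -> R) : P.-integrable setT (EFin \o xi) ->
  \int[P]_w (xi w * g (N n w)) @[n --> \oo] --> (\int[P]_w xi w) * c.
Proof.
move=> xi_i; have [mg [M gM]] := g_bm.
have h := correlation_cvg0 xi_i.
have -> : (fun n => \int[P]_w (xi w * g (N n w))) =
    (fun n => \int[P]_w (xi w * U n w) + (\int[P]_w xi w) * c).
  apply/funext => n.
  have -> : \int[P]_w (xi w * g (N n w)) = \int[P]_w (xi w * U n w + c * xi w).
    by apply: eq_Rintegral => w _; rewrite /U; ring.
  rewrite Rintegral_lincomb// 1?mulrC//.
  have [mU [B UB]] := U_bm n.
  exact: integrable_mul_bounded UB.
rewrite -[X in _ --> X]add0r; apply: cvgD => //; exact: cvg_cst.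
Qed.

End sparse_independence_is_mixing.

(** * Transfer of mixing to asymptotically equivalent pairs *)

Section continuous_functions_of_pairs.
Context (R : realType) (h : 'cV[R]_2 -> R).
Hypothesis h_cont : continuous h.

Lemma continuous_cv2 (a b e : R) : 0 < e -> exists2 del, 0 < del &
  forall a' b', `|a' - a| < del -> `|b' - b| < del ->
  `|h (cv2 a' b') - h (cv2 a b)| < e.
Proof.
move=> e0; have /cvgrPdist_lt/(_ e e0) := @h_cont (cv2 a b).
move=> /nbhs_ballP[del /= del0 H]; exists del => // a' b' aa bb.
rewrite distrC; apply: H; split => // i j.
rewrite !mxE /ball/=; case: ifP => _.
  by rewrite distrC.
by rewrite distrC.
Qed.

(** Only the points of a compact segment are constrained; the perturbed point
    [(a, b)] may leave the line.  Hence a covering argument over the segment. *)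
Lemma uniformly_continuous_on_line (K s e : R) : 0 < e ->
  exists2 del, 0 < del & forall t a b, `|t| <= K -> `|a - t| < del ->
  `|b - s * t| < del -> `|h (cv2 a b) - h (cv2 t (s * t))| < e.
Proof.
move=> e0; have e20 : 0 < e / 2 by rewrite divr_gt0.
have /compact_near_coveringP cK := @segment_compact R (- K) K.
pose Q (del t : R) := forall a b, `|a - t| < del ->
  `|b - s * t| < del -> `|h (cv2 a b) - h (cv2 t (s * t))| < e.
have : \forall del \near (0 : R)^'+, `[- K, K]%classic `<=` Q del.
  apply: (cK _ _ Q) => x _.
  have [eta eta0 H] := continuous_cv2 x (s * x) e20.
  pose rad := eta / 2 / (`|s| + 1).
  have s10 : 0 < `|s| + 1 by rewrite ltr_wpDl.
  have rad0 : 0 < rad by rewrite !divr_gt0.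
  have rad1 : rad <= eta / 2 by rewrite ler_pdivrMr// ler_peMr ?lerDr// ltW// divr_gt0.
  have rads : `|s| * rad <= eta / 2.
    rewrite /rad mulrCA ler_piMr ?(ltW (divr_gt0 _ _))// ler_pdivrMr// mul1r lerDl//.
  exists (ball x rad, [set del | del < eta / 2]).
    split; first exact: nbhsx_ballx.
    by apply: nbhs_right_lt; rewrite divr_gt0.
  move=> [t del] [/= xt del2] a b at_ bt.
  have tx : `|t - x| < rad by rewrite distrC.
  have stx : `|s * t - s * x| <= eta / 2.
    by rewrite -mulrBr normrM (le_trans _ rads)// ler_wpM2l// ltW.
  have Ht : `|h (cv2 t (s * t)) - h (cv2 x (s * x))| < e / 2.
    apply: H.
      rewrite (lt_le_trans tx)// (le_trans rad1)// ler_pdivrMr//.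
      by rewrite ler_peMr ?ltW// ltrDl.
    by rewrite (le_lt_trans stx)// ltr_pdivrMr// ltr_pMr// ltrDl.
  have Ha : `|h (cv2 a b) - h (cv2 x (s * x))| < e / 2.
    apply: H.
      rewrite -(subrK t a) -addrA (le_lt_trans (ler_normD _ _))// [eta]splitr.
      by rewrite ltrD ?(lt_le_trans tx)// (lt_trans at_).
    rewrite -(subrK (s * t) b) -addrA (le_lt_trans (ler_normD _ _))// [eta]splitr.
    by rewrite ltr_leD// (lt_trans bt).
  rewrite -(subrK (h (cv2 x (s * x))) (h (cv2 a b))) -addrA.
  rewrite (le_lt_trans (ler_normD _ _))// [e]splitr ltrD//.
  by rewrite distrC.
move=> near_del.
have [del [del0 H]] : exists del, 0 < del /\ `[- K, K]%classic `<=` Q del.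
  near (0 : R)^'+ => del; exists del; split; last by near: del.
  by near: del; exact: nbhs_right_gt.
exists del => // t a b tK; apply: H.
by rewrite /= in_itv/= -ler_norml.
Unshelve. all: by end_near. Qed.

Definition grid (k : nat) (x : R) : R := (Num.floor (x * k.+1%:R))%:~R / k.+1%:R.

Lemma grid_dist k x : `|grid k x - x| <= k.+1%:R^-1.
Proof.
have k0 : 0 < k.+1%:R :> R by rewrite ltr0n.
have /andP[f1 f2] := real_floor_itv (num_real (x * k.+1%:R)).
have -> : grid k x - x = ((Num.floor (x * k.+1%:R))%:~R - x * k.+1%:R) / k.+1%:R.
  by rewrite /grid mulrBl mulfK// gt_eqF.
rewrite normrM normfV (gtr0_norm k0) ler_piMl ?invr_ge0 ?(ltW k0)//.
by move: f2; rewrite ler_norml intrD => f2; apply/andP; split; lra.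
Qed.

(** Replacing [a] and [b] by their values on a grid gives functions with countably
    many values, and these converge pointwise because [h] is continuous. *)
Lemma measurable_continuous_cv2 d (T : measurableType d) (a b : T -> R) :
  measurable_fun setT a -> measurable_fun setT b ->
  measurable_fun setT (fun w => h (cv2 (a w) (b w))).
Proof.
move=> ma mb.
apply: (@measurable_fun_cvg _ _ _ setT
  (fun k w => h (cv2 (grid k (a w)) (grid k (b w))))); last first.
  move=> w _; apply/cvgrPdist_lt => e e0.
  have [del del0 H] := continuous_cv2 (a w) (b w) e0.
  have : \forall k \near \oo, k.+1%:R^-1 < del.
    exists (Num.bound del^-1) => // k /= bk.
    rewrite invf_plt ?posrE ?ltr0n//.
    apply: (lt_le_trans (archi_boundP _)); first by rewrite invr_ge0 ltW.
    by rewrite ler_nat leqW.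
  apply: filterS => k kdel; rewrite distrC; apply: H.
    exact: le_lt_trans (grid_dist _ _) kdel.
  exact: le_lt_trans (grid_dist _ _) kdel.
move=> k _ B mB; rewrite setTI.
have mfloor (f : T -> R) (i : int) : measurable_fun setT f ->
    measurable [set w | Num.floor (f w * k.+1%:R) = i].
  move=> mf; have -> : [set w | Num.floor (f w * k.+1%:R) = i] =
      (fun w => f w * k.+1%:R) @^-1` `[i%:~R, (i + 1)%:~R[%classic.
    apply/seteqP; split => w /=; rewrite in_itv/=.
      by move=> <-; exact: (real_floor_itv (num_real _)).
    by move=> H; exact: floor_def.
  rewrite -[X in measurable X]setTI.
  by apply: measurable_funM.
pose F (ij : int * int) : set T :=
  if pselect (B (h (cv2 (ij.1%:~R / k.+1%:R) (ij.2%:~R / k.+1%:R)))) then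
    [set w | Num.floor (a w * k.+1%:R) = ij.1] `&`
    [set w | Num.floor (b w * k.+1%:R) = ij.2]
  else set0.
have -> : (fun w => h (cv2 (grid k (a w)) (grid k (b w)))) @^-1` B =
    \bigcup_ij F ij.
  apply/seteqP; split => [w /= wB|w [[i j] _]].
    exists (Num.floor (a w * k.+1%:R), Num.floor (b w * k.+1%:R)) => //.
    by rewrite /F; case: pselect.
  by rewrite /F/=; case: pselect => // Bij [/= ai bj]; rewrite /grid ai bj.
apply: countable_bigcupT_measurable => [|ij]; first exact: countableP.
rewrite /F; case: pselect => [Bij|nB]; last exact: measurable0.
by apply: measurableI; exact: mfloor.
Qed.

End continuous_functions_of_pairs.

(** The pair [(a n, b n)] is asymptotic to [N n] times [(1, s)] up to the random
    sign of [y].  Mixing of [N] against every integrable [xi] allows [xi] to be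
    split along this sign, and the symmetry of the limit law makes both pieces
    converge to the same expectation. *)
Section transfer_of_mixing.
Context d (T : measurableType d) (R : realType) (P : probability T R).
Variables (a b N : nat -> T -> R) (y U : T -> R) (s : R).
Hypotheses (ma : forall n, measurable_fun setT (a n))
  (mb : forall n, measurable_fun setT (b n))
  (mN : forall n, measurable_fun setT (N n))
  (my : measurable_fun setT y) (mU : measurable_fun setT U).
Hypothesis N_mixing : forall (xi : T -> R) (g : R -> R),
  P.-integrable setT (EFin \o xi) -> bounded_measurable g ->
  \int[P]_w (xi w * g (N n w)) @[n --> \oo] -->
  (\int[P]_w xi w) * (\int[P]_w g (U w)).
Hypothesis U_sym : forall g : R -> R, bounded_measurable g ->
  \int[P]_w g (- U w) = \int[P]_w g (U w).
Hypothesis y_neq0 : {ae P, forall w, y w != 0}.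
Hypothesis ab_N : {ae P, forall w, y w != 0 ->
  (a n w - Num.sg (y w) * N n w @[n --> \oo] --> 0) /\
  (b n w - Num.sg (y w) * s * N n w @[n --> \oo] --> 0)}.

Lemma escape_probability_cvg0 :
  \int[P]_w \1_[set x : R | K%:R < `|x|] (U w) @[K --> \oo] --> 0.
Proof.
apply: (@Rintegral_dominated_cvg0 _ _ _ P _ (cst 1)).
- move=> K; apply: measurableT_comp => //; apply: measurable_indic.
  have -> : [set x : R | K%:R < `|x|] = [set x | (fun x => K%:R < `|x|) x] by [].
  rewrite -[X in measurable X]setTI.
  by apply: measurable_fun_ltr => //; exact: measurable_cst.
- apply: aeW => w; apply: cvg_near_cst; exists (Num.bound `|U w|) => // K /= UK.
  rewrite indicE memNset//= => /lt_le_trans/(_ (ltW (archi_boundP (normr_ge0 (U w))))).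
  by rewrite ltr_nat ltnNge UK.
- by apply: bounded_measurable_integrable; exact: bounded_measurable_cst.
- by move=> K w; rewrite indicE; case: (_ \in _); rewrite ?normr1 ?normr0 ?ler01.
Qed.

Variables (h : 'cV[R]_2 -> R) (M : R).
Hypotheses (h_cont : continuous h) (hM : forall x, `|h x| <= M).

Let g (x : R) := h (cv2 x (s * x)).

Let g_bm : bounded_measurable g.
Proof.
split; last by exists M => x; exact: hM.
by apply: measurable_continuous_cv2 => //; exact: measurable_funM.
Qed.

Let g'_bm : bounded_measurable (fun x : R => g (- x)).
Proof.
have [mg [B gB]] := g_bm; split; last by exists B => x; exact: gB.
by apply: measurableT_comp mg _; exact: measurable_funN.
Qed.

Let pos : T -> R := \1_[set w | 0 < y w].

Let mpos : bounded_measurable pos.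
Proof.
split.
  apply: measurable_indic; rewrite -[X in measurable X]setTI.
  by apply: measurable_fun_ltr => //; exact: measurable_cst.
by exists 1 => w; rewrite /pos indicE; case: (_ \in _); rewrite ?normr1 ?normr0 ?ler01.
Qed.

Let signed n w := pos w * g (N n w) + (1 - pos w) * g (- N n w).

Let signedE n w : y w != 0 -> signed n w = g (Num.sg (y w) * N n w).
Proof.
move=> y0; rewrite /signed /pos indicE; case: (ltgtP (y w) 0) y0 => // yw _.
  by rewrite memNset ?mul0r ?add0r ?subr0 ?mul1r ?ltr0_sg ?mulN1r//= ltNge ltW.
by rewrite mem_set// gtr0_sg// !mul1r subrr mul0r addr0.
Qed.

Let signedM n w : `|signed n w| <= M.
Proof.
rewrite /signed /pos indicE; case: (_ \in _).
  by rewrite mul1r subrr mul0r addr0 hM.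
by rewrite mul0r add0r subr0 mul1r hM.
Qed.

Let m_signed n : measurable_fun setT (signed n).
Proof.
have [mp _] := mpos.
apply: measurable_funD; apply: measurable_funM => //.
- exact: (measurableT_comp (proj1 g_bm) (mN n)).
- exact: measurable_funB.
- exact: (measurableT_comp (proj1 g'_bm) (mN n)).
Qed.

Let H n w := h (cv2 (a n w) (b n w)).

Let mH n : measurable_fun setT (H n).
Proof. exact: measurable_continuous_cv2. Qed.

Let D n w := H n w - signed n w.

Let DM n w : `|D n w| <= 2 * M.
Proof.
by rewrite (le_trans (ler_normB _ _))// mulrDl mul1r lerD// hM.
Qed.

Let near_indic K n w : R := \1_[set x : R | `|x| <= K%:R] (N n w).

Let far_indic K (x : R) : R := \1_[set x : R | K%:R < `|x|] x.

Let far_bm K : bounded_measurable (far_indic K).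
Proof.
split.
  apply: measurable_indic; rewrite -[X in measurable X]setTI.
  by apply: measurable_fun_ltr.
exists 1 => w; rewrite /far_indic indicE.
by case: (_ \in _); rewrite ?normr1 ?normr0 ?ler01.
Qed.

Let D_cvg0 K : {ae P, forall w, D n w * near_indic K n w @[n --> \oo] --> 0}.
Proof.
move: y_neq0 ab_N; apply: filterS2 => w y0 /(_ y0)[aw bw].
apply/cvgr0Pnorm_lt => e e0.
have [del del0 Hdel] := uniformly_continuous_on_line h_cont K%:R s e0.
have /cvgr0Pnorm_lt/(_ del del0) := aw.
have /cvgr0Pnorm_lt/(_ del del0) := bw.
apply: filterS2 => n bn an.
rewrite /near_indic indicE; have [NK|_] := boolP (_ \in _); last first.
  by rewrite mulr0 normr0.
rewrite mulr1 /D signedE//; apply: Hdel => //.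
  move: NK; rewrite inE /= normrM normr_sg y0 mul1r; exact.
by rewrite mulrA [s * _]mulrC.
Qed.

(** The error is negligible where [N n] stays in a compact interval, by
    dominated convergence, and elsewhere because [N n] rarely leaves it. *)
Lemma mixing_transfer_error (xi : T -> R) : P.-integrable setT (EFin \o xi) ->
  \int[P]_w (xi w * D n w) @[n --> \oo] --> 0.
Proof.
move=> xi_i; have mxi : measurable_fun setT xi.
  by apply/measurable_EFinP; exact: measurable_int xi_i.
have axi_i : P.-integrable setT (EFin \o (fun w => `|xi w|)) by exact: integrable_norm.
have mD n : measurable_fun setT (D n) by exact: measurable_funB.
have near_m K n : measurable_fun setT (near_indic K n).
  apply: measurableT_comp => //; apply: measurable_indic.
  rewrite -[X in measurable X]setTI.
  by apply: measurable_fun_ler => //; exact: normr_measurable.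
have near_ge0 K n w : 0 <= near_indic K n w <= 1.
  by rewrite /near_indic indicE; case: (_ \in _); rewrite ?lexx ?ler01.
have split1 K n w : near_indic K n w + far_indic K (N n w) = 1.
  rewrite /near_indic /far_indic !indicE; have [NK|NK] := lerP `|N n w| K%:R.
    by rewrite mem_set// memNset ?addr0//= ltNge NK.
  by rewrite memNset ?mem_set ?add0r//= leNgt NK.
have M0 : 0 <= M by rewrite (le_trans _ (hM 0)).
pose F K n w := `|xi w| * (`|D n w| * near_indic K n w).
have FM K n w : `|F K n w| <= 2 * M * `|xi w|.
  have /andP[n0 n1] := near_ge0 K n w.
  rewrite /F normrM normr_id mulrC ler_wpM2r// normrM normr_id (ger0_norm n0).
  by rewrite (le_trans _ (DM n w))// ler_piMr.
have F_cvg K : \int[P]_w F K n w @[n --> \oo] --> 0.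
  apply: (@Rintegral_dominated_cvg0 _ _ _ P _ (fun w => 2 * M * `|xi w|)).
  - move=> n; apply: measurable_funM; first exact: measurableT_comp.
    by apply: measurable_funM => //; exact: measurableT_comp.
  - apply: filterS (D_cvg0 K) => w Dw.
    rewrite -[X in _ --> X](mulr0 `|xi w|).
    apply: cvgM; first exact: cvg_cst.
    have -> : (fun n => `|D n w| * near_indic K n w) =
              (fun n => `|D n w * near_indic K n w|).
      apply/funext => n; have /andP[n0 _] := near_ge0 K n w.
      by rewrite normrM (ger0_norm n0).
    by rewrite -[X in _ --> X](@normr0 R R); exact: cvg_norm.
  - by apply: eq_integrable (integrableZl measurableT (2 * M) axi_i).
  - exact: FM.
apply/cvgr0Pnorm_lt => e e0.
have e20 : 0 < e / 2 by rewrite divr_gt0.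
pose E := \int[P]_w `|xi w|.
have [K HK] : exists K : nat,
    2 * M * (E * \int[P]_w far_indic K (U w)) < e / 2.
  have h0 : 2 * M * (E * \int[P]_w far_indic K (U w)) @[K --> \oo] --> 0.
    rewrite [X in _ --> X](_ : 0 = 2 * M * (E * 0)); last by rewrite !mulr0.
    apply: cvgM; first exact: cvg_cst.
    apply: cvgM; first exact: cvg_cst.
    exact: escape_probability_cvg0.
  have [K _ HK] := cvgr_lt _ h0 _ e20.
  by exists K; apply: HK => /=.
have far_cvg : 2 * M * \int[P]_w (`|xi w| * far_indic K (N n w)) @[n --> \oo] -->
    2 * M * (E * \int[P]_w far_indic K (U w)).
  by apply: cvgM; [exact: cvg_cst|exact: N_mixing].
have [k1 _ far_lt] := cvgr_lt _ far_cvg _ HK.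
have /cvgr0Pnorm_lt/(_ _ e20)[k2 _ F_lt] := F_cvg K.
exists (maxn k1 k2) => // n /=; rewrite geq_max => /andP[k1n k2n].
have {far_lt}farn := far_lt n k1n; have {F_lt}Fn := F_lt n k2n.
have far_m : measurable_fun setT (fun w => far_indic K (N n w)).
  exact: (measurableT_comp (proj1 (far_bm K)) (mN n)).
have far_M w : `|far_indic K (N n w)| <= 1.
  by rewrite /far_indic indicE; case: (_ \in _); rewrite ?normr1 ?normr0 ?ler01.
have xiD_i : P.-integrable setT (EFin \o (fun w => xi w * D n w)).
  exact: integrable_mul_bounded (DM n).
have far_i : P.-integrable setT (EFin \o (fun w => `|xi w| * far_indic K (N n w))).
  exact: integrable_mul_bounded far_M.
have F_i : P.-integrable setT (EFin \o F K n).
  apply: (@integrable_mul_bounded _ _ _ _ _ _ (2 * M)) => //.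
    by apply: measurable_funM => //; exact: measurableT_comp.
  move=> w; have /andP[n0 n1] := near_ge0 K n w.
  by rewrite normrM normr_id (ger0_norm n0) (le_trans _ (DM n w))// ler_piMr.
rewrite (le_lt_trans (le_normr_Rintegral _ xiD_i))// [e]splitr.
apply: (@le_lt_trans _ _ (\int[P]_w F K n w +
    2 * M * \int[P]_w (`|xi w| * far_indic K (N n w)))); last first.
  by apply: ltrD => //; exact: le_lt_trans (ler_norm _) Fn.
rewrite -Rintegral_lincomb//; apply: le_Rintegral => //.
- exact: (integrable_norm xiD_i).
- have := integrableD measurableT F_i (integrableZl measurableT (2 * M) far_i).
  by apply: eq_integrable.
move=> w _; rewrite normrM /F.
have f0 : 0 <= far_indic K (N n w).
  by rewrite /far_indic indicE; case: (_ \in _); rewrite ?ler01.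
have -> : `|xi w| * `|D n w| = `|xi w| * (`|D n w| * near_indic K n w) +
    `|D n w| * (`|xi w| * far_indic K (N n w)).
  by rewrite -[LHS]mulr1 -[X in _ * X = _](split1 K n w); ring.
by rewrite lerD2l; apply: ler_wpM2r; [rewrite mulr_ge0|exact: DM].
Qed.

Lemma mixing_transfer (xi : T -> R) : P.-integrable setT (EFin \o xi) ->
  \int[P]_w (xi w * h (cv2 (a n w) (b n w))) @[n --> \oo] -->
  (\int[P]_w xi w) * (\int[P]_w h (cv2 (U w) (s * U w))).
Proof.
move=> xi_i; have mxi : measurable_fun setT xi.
  by apply/measurable_EFinP; exact: measurable_int xi_i.
have [mp [B pB]] := mpos.
have p_i : P.-integrable setT (EFin \o (fun w => xi w * pos w)).
  exact: integrable_mul_bounded pB.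
have q_bm : bounded_measurable (fun w => 1 - pos w).
  split; first exact: measurable_funB.
  exists (1 + B) => w; rewrite (le_trans (ler_normB _ _))// normr1 lerD2l//.
have q_i : P.-integrable setT (EFin \o (fun w => xi w * (1 - pos w))).
  by have [mq [C qC]] := q_bm; exact: integrable_mul_bounded qC.
have l1 := N_mixing p_i g_bm.
have := N_mixing q_i g'_bm; rewrite U_sym// => l2.
have gM n : bounded_measurable (fun w => g (N n w)) by exact: bounded_measurable_comp.
have gM' n : bounded_measurable (fun w => g (- N n w)).
  exact: (bounded_measurable_comp (mN n) g'_bm).
have i1 n : P.-integrable setT (EFin \o (fun w => xi w * pos w * g (N n w))).
  by have [m1 [C1 b1]] := gM n; exact: integrable_mul_bounded b1.
have i2 n : P.-integrable setT (EFin \o (fun w => xi w * (1 - pos w) * g (- N n w))).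
  by have [m1 [C1 b1]] := gM' n; exact: integrable_mul_bounded b1.
have i3 n : P.-integrable setT (EFin \o (fun w => xi w * D n w)).
  apply: integrable_mul_bounded (DM n) => //; exact: measurable_funB.
have i12 n : P.-integrable setT (EFin \o (fun w => xi w * pos w * g (N n w) +
    xi w * (1 - pos w) * g (- N n w))).
  by apply: eq_integrable (integrableD measurableT (i1 n) (i2 n)).
have -> : (fun n => \int[P]_w (xi w * h (cv2 (a n w) (b n w)))) = (fun n =>
    \int[P]_w (xi w * D n w) + (\int[P]_w (xi w * pos w * g (N n w)) +
    \int[P]_w (xi w * (1 - pos w) * g (- N n w)))).
  apply/funext => n; rewrite -RintegralD// -RintegralD//.
  by apply: eq_Rintegral => w _; rewrite /D /signed /H; ring.
rewrite -[X in _ --> X](_ : 0 + (\int[P]_w (xi w * pos w) * \int[P]_w g (U w) +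
    \int[P]_w (xi w * (1 - pos w)) * \int[P]_w g (U w)) = _).
  exact: cvgD (mixing_transfer_error xi_i) (cvgD l1 l2).
rewrite add0r -mulrDl -RintegralD//; congr (_ * _).
by apply: eq_Rintegral => w _; ring.
Qed.

End transfer_of_mixing.

(** * Conditional expectations *)

Section conditional_expectations.
Context d (T : measurableType d) (R : realType) (P : probability T R).
Implicit Types (G : set (set T)) (Y V : T -> R).

Lemma is_condexp_measurable G Y V : G `<=` measurable -> is_condexp P G Y V ->
  measurable_fun setT V.
Proof. by move=> GM [GV _ _] _ B mB; rewrite setTI; apply: GM; exact: GV. Qed.

(** Two versions agree almost everywhere because their integrals agree on all
    events of [G], which are all the measurable sets once [P] is pushed forward
    to [T] equipped with [G]. *)
Lemma is_condexp_unique G Y V V' : sigma_algebra setT G -> G `<=` measurable ->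
  is_condexp P G Y V -> is_condexp P G Y V' ->
  ae_eq P setT (EFin \o V) (EFin \o V').
Proof.
move=> sG GM [GV iV VE] [GV' iV' VE'].
pose T' := g_sigma_algebraType G.
have GE A : measurable (A : set T') = G A.
  by rewrite /measurable/= sigma_algebra_id.
pose f : T -> T' := idfun.
have mf : measurable_fun setT f.
  by move=> _ B; rewrite GE setTI => /GM.
pose F : {mfun T >-> T'} := HB.pack f (isMeasurableFun.Build _ _ _ _ f mf).
pose nu : probability T' R := distribution P F.
have mW W : (forall B, measurable B -> G (W @^-1` B)) ->
    measurable_fun setT (EFin \o W : T' -> \bar R).
  by move=> GW; apply/measurable_EFinP => _ B mB; rewrite setTI GE; exact: GW.
have int_pull W (A : set T') : (forall B, measurable B -> G (W @^-1` B)) ->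
    P.-integrable setT (EFin \o W) -> measurable A ->
    (\int[nu]_(x in A) (W x)%:E = \int[P]_(x in A) (W x)%:E)%E.
  move=> GW iW mA; rewrite integral_pushforward//; first exact: mW.
  by apply: (integrableS measurableT) => //; apply: GM; rewrite -GE.
have iVnu : nu.-integrable setT (EFin \o V).
  apply/integrableP; split; first exact: mW.
  case/integrableP: iV => _; rewrite ge0_integral_pushforward//.
  by apply: measurableT_comp => //; exact: mW.
have : ae_eq nu setT (EFin \o V) (EFin \o V').
  apply: integral_ae_eq => //; first exact: mW.
  move=> E _ mE; have GE' : G E by rewrite -GE.
  transitivity (\int[P]_(x in E) (V x)%:E)%E; first exact: int_pull.
  transitivity (\int[P]_(x in E) (V' x)%:E)%E; first by rewrite VE// VE'.
  by apply/esym; exact: int_pull.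
move=> [N [mN N0 subN]]; exists N; split => //.
by apply: GM; rewrite -GE.
Qed.

Lemma expectation_mul_condexp G Y V (xi : {RV P >-> R}) :
  sigma_algebra setT G -> G `<=` measurable -> P.-integrable setT (EFin \o Y) ->
  is_condexp P G Y V ->
  'E_P[fun w => (xi w * condexp P G Y w)%R]%E = 'E_P[fun w => (xi w * V w)%R]%E.
Proof.
move=> sG GM iY cV; have cE := condexpP sG GM iY.
rewrite unlock; apply: ae_eq_integral => //.
- apply/measurable_EFinP; apply: measurable_funM; first exact: measurable_funP.
  exact: is_condexp_measurable cE.
- apply/measurable_EFinP; apply: measurable_funM; first exact: measurable_funP.
  exact: is_condexp_measurable cV.
have := is_condexp_unique sG GM cE cV; apply: filterS => w /(_ Logic.I)/= [wE] _.
by rewrite wE.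
Qed.

Lemma is_condexp_self G Y : measurable_wrt G Y -> P.-integrable setT (EFin \o Y) ->
  is_condexp P G Y Y.
Proof. by move=> GY iY; split. Qed.

(** The indicator of an event of [G] is a random variable independent of [U], so
    the product rule for expectations applies to it. *)
Lemma is_condexp_cst G (U : T -> R) (f : R -> R) : sigma_algebra setT G ->
  G `<=` measurable -> measurable_fun setT U ->
  independent_sigma P (g_sigma_algebra_preimage U) G -> bounded_measurable f ->
  is_condexp P G (f \o U) (cst (\int[P]_w f (U w))).
Proof.
move=> sG GM mU UG f_bm; have [mf [M fM]] := f_bm.
have [G0 GC GU] := sG.
have GT : G setT by rewrite -(setD0 setT); exact: GC.
have fU_bm : bounded_measurable (f \o U) by exact: bounded_measurable_comp.
split.
- move=> B mB; rewrite preimage_cst; case: ifP => _ //.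
- by apply: bounded_measurable_integrable; exact: bounded_measurable_cst.
move=> A GA; have mA := GM _ GA.
have iA : independent_funs P U (\1_A : T -> R).
  apply: independent_sigma_funs UG _ _.
    by move=> B mB; exists B => //; rewrite setTI.
  move=> B mB; have -> : (\1_A : T -> R) @^-1` B =
      if pselect (B 1) then (if pselect (B 0) then setT else A)
      else (if pselect (B 0) then setT `\` A else set0).
    apply/seteqP; split => w /=; rewrite indicE; have [wA|wA] := boolP (w \in A);
    case: pselect => B1; case: pselect => B0 //=; move: wA; rewrite ?notin_setE ?inE//.
    by move=> nA [].
  by case: pselect => B1; case: pselect => B0 //; exact: GC.
have m01 : measurable_fun setT (\1_[set 1] : R -> R) by exact: measurable_indic.
have b01 (x : R) : `|\1_[set 1] x| <= Num.max M 1 :> R.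
  by rewrite indicE; case: (_ \in _); rewrite ?normr1 ?normr0 le_max ?lexx ?ler01 orbT.
have fM' x : `|f x| <= Num.max M 1 by rewrite le_max fM.
have mI : measurable_fun setT (\1_A : T -> R) by exact: measurable_indic.
have indE w : (\1_[set 1] (\1_A w : R) : R) = \1_A w.
  rewrite !indicE; case: (w \in A); first by rewrite mem_set.
  by rewrite memNset//= => /esym/eqP; rewrite oner_eq0.
have PA : \int[P]_w (\1_A w : R) = fine (P A).
  by rewrite /Rintegral integral_indic// setIT.
have := independent_funs_Rintegral mU mI iA mf fM' m01 b01.
under eq_Rintegral do rewrite indE.
under [X in _ = _ * X]eq_Rintegral do rewrite indE.
rewrite PA => key.
transitivity (\int[P]_(w in A) cst (\int[P]_w f (U w))%:E w)%E; first by [].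
rewrite integral_cst//.
have -> : (\int[P]_(w in A) ((f \o U) w)%:E = (\int[P]_w (f (U w) * \1_A w))%R%:E)%E.


  rewrite /Rintegral fineK; last first.
    apply: integrable_fin_num => //.
    apply: bounded_measurable_integrable.
    apply: bounded_measurableM => //; split=> //; exists 1 => w.
    by rewrite indicE; case: (_ \in _); rewrite ?normr1 ?normr0.
  rewrite [LHS]integral_mkcond; apply: eq_integral => w _.
  by rewrite patchE indicE; case: (w \in A); rewrite ?mulr1 ?mulr0.
by rewrite key EFinM; congr (_ * _)%E; rewrite fineK ?fin_num_measure.
Qed.

End conditional_expectations.

(** * The estimator *)

Section normal_equations.
Context (R : realType).

Lemma sum_residual_orthogonal n (r e : nat -> R) :
  (forall t, \sum_(k < n) r k ^+ 2 <= \sum_(k < n) (r k - t * e k) ^+ 2) ->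
  \sum_(k < n) r k * e k = 0.
Proof.
set b := \sum_(k < n) r k * e k; set a := \sum_(k < n) e k ^+ 2 => h.
have a0 : 0 <= a by apply: sumr_ge0 => k _; exact: sqr_ge0.
have expand t : \sum_(k < n) (r k - t * e k) ^+ 2 =
    \sum_(k < n) r k ^+ 2 + (t ^+ 2 * a - 2 * t * b).
  rewrite /a /b !mulr_sumr -sumrB -big_split/=.
  by apply: eq_bigr => k _; ring.
(* the [+ 1] keeps the step meaningful when [e] vanishes identically *)
have := h (b / (a + 1)); rewrite expand lerDl.
have -> : (b / (a + 1)) ^+ 2 * a - 2 * (b / (a + 1)) * b =
    - (b ^+ 2 * (a + 2) / (a + 1) ^+ 2).
  by field; rewrite gt_eqF// ltr_wpDl.
rewrite oppr_ge0 pmulr_lle0 ?invr_gt0 ?exprn_gt0 ?ltr_wpDl//.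
rewrite pmulr_lle0 ?ltr_wpDl// => b2.
by apply/eqP; rewrite -sqrf_eq0 eq_le b2 sqr_ge0.
Qed.

Lemma ar2_rss_min_orthogonal n (x : nat -> R) (th : 'cV[R]_2) :
  (forall th', ar2_rss n x th <= ar2_rss n x th') ->
  forall u v : R, \sum_(k < n)
    (x k.+2 - th 0 0 * x k.+1 - th 1 0 * x k) * (u * x k.+1 + v * x k) = 0.
Proof.
move=> min u v.
apply: (@sum_residual_orthogonal n
  (fun k => x k.+2 - th 0 0 * x k.+1 - th 1 0 * x k)
  (fun k => u * x k.+1 + v * x k)) => t.
apply: le_trans (min (cv2 (th 0 0 + t * u) (th 1 0 + t * v))) _.
rewrite le_eqVlt; apply/orP; left; apply/eqP; apply: eq_bigr => k _.
by rewrite !mxE/=; congr (_ ^+ 2); ring.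
Qed.

Lemma sqrtr_div (s : R) : 0 <= s -> Num.sqrt s = s / Num.sqrt s.
Proof.
move=> s0; have [->|sn0] := eqVneq s 0; first by rewrite sqrtr0 mul0r.
rewrite -{2}(sqr_sqrtr s0) expr2 mulfK// gt_eqF// sqrtr_gt0.
by rewrite lt_neqAle eq_sym sn0.
Qed.

(** The scaling matrix is the design matrix with each row divided by the root of
    a sum of squares, so the normal equations turn the scaled error into sums of
    residuals at [(th1, th2)].  If a sum of squares is zero, the corresponding row
    and the corresponding ratio both vanish, as [x / 0 = 0]. *)
Lemma scaled_lse_error n (x : nat -> R) (th : 'cV[R]_2) (th1 th2 : R) :
  (forall th', ar2_rss n x th <= ar2_rss n x th') ->
  let z k := x k.+2 - (th1 * x k.+1 + th2 * x k) in
  lse_scaling n x *m (th - cv2 th1 th2) =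
  cv2 ((\sum_(k < n) z k * x k.+1) / Num.sqrt (\sum_(k < n) x k.+1 ^+ 2))
      ((\sum_(k < n) z k * x k) / Num.sqrt (\sum_(k < n) x k ^+ 2)).
Proof.
move=> min z; have orth := ar2_rss_min_orthogonal min.
have e1 : \sum_(k < n) z k * x k.+1 =
    (\sum_(k < n) x k.+1 ^+ 2) * (th 0 0 - th1) +
    (\sum_(k < n) x k.+1 * x k) * (th 1 0 - th2).
  rewrite -[LHS]subr0 -[X in _ - X](orth 1 0) -sumrB !mulr_suml -big_split/=.
  by apply: eq_bigr => k _; rewrite /z; ring.
have e2 : \sum_(k < n) z k * x k =
    (\sum_(k < n) x k.+1 * x k) * (th 0 0 - th1) +
    (\sum_(k < n) x k ^+ 2) * (th 1 0 - th2).
  rewrite -[LHS]subr0 -[X in _ - X](orth 0 1) -sumrB !mulr_suml -big_split/=.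
  by apply: eq_bigr => k _; rewrite /z; ring.
have s11 : 0 <= \sum_(k < n) x k.+1 ^+ 2 by apply: sumr_ge0 => k _; exact: sqr_ge0.
have s22 : 0 <= \sum_(k < n) x k ^+ 2 by apply: sumr_ge0 => k _; exact: sqr_ge0.
apply/colP => j; rewrite !mxE !big_ord_recl big_ord0 !mxE/= e1 e2.
have -> : lift ord0 ord0 = 1 :> 'I_2 by apply/val_inj.
case: j => -[|[|//]] jlt /=.
  by rewrite [X in X * _]sqrtr_div//; ring.
by rewrite [X in _ + (X * _ + _)]sqrtr_div//; ring.
Qed.

End normal_equations.

Section measurability_of_the_estimator.
Context d (T : measurableType d) (R : realType) (P : probability T R).
Variable X : nat -> {RV P >-> R}.

Lemma ar2_sigma_infty_coord j : measurable_wrt (ar2_sigma_infty X) (X j).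
Proof.
move=> B mB; apply: sub_sigma_algebra; exists j => //; apply: sub_sigma_algebra.
rewrite -bigcup_mkord_ord; exists j => /=; first by rewrite ltnS leqnSn.
by exists B => //; rewrite setTI inordK// ltnS leqnSn.
Qed.

Lemma ar2_sigma_infty_measurable : ar2_sigma_infty X `<=` measurable.
Proof.
apply: smallest_sub; first exact: sigma_algebra_measurable.
move=> A [n _]; apply: smallest_sub; first exact: sigma_algebra_measurable.
apply: (big_ind (fun S : set (set T) => S `<=` measurable)) => //.
- by move=> S S' mS mS'; rewrite subUset.
- by move=> j _ _ [B mB <-]; apply: measurable_funP.
Qed.

Lemma ar2_sigma_infty_sigma_algebra : sigma_algebra setT (ar2_sigma_infty X).
Proof. exact: smallest_sigma_algebra. Qed.

End measurability_of_the_estimator.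

Section measurable_ratio.
Context d (T : measurableType d) (R : realType).

Lemma measurable_sqrtV (f : T -> R) : measurable_fun setT f ->
  (forall w, 0 <= f w) -> measurable_fun setT (fun w => (Num.sqrt (f w))^-1).
Proof.
move=> mf f0.
have -> : (fun w => (Num.sqrt (f w))^-1) = (fun w => f w `^ (- 2^-1)).
  apply/funext => w; rewrite powRN powR12_sqrt//.
exact: (measurableT_comp (measurable_powR _) mf).
Qed.

Lemma measurable_self_normalized n (x z : nat -> T -> R) :
  (forall k, measurable_fun setT (x k)) -> (forall k, measurable_fun setT (z k)) ->
  measurable_fun setT (fun w =>
    (\sum_(k < n) z k w * x k w) / Num.sqrt (\sum_(k < n) x k w ^+ 2)).
Proof.
move=> mx mz; apply: measurable_funM.
  by apply: measurable_sum => k; exact: measurable_funM.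
apply: measurable_sqrtV; first by apply: measurable_sum => k; exact: measurable_funX.
by move=> w; apply: sumr_ge0 => k _; exact: sqr_ge0.
Qed.

End measurable_ratio.

Lemma ar2_roots (R : realType) (th1 th2 lam mu : R) :
  root (ar2_charpoly th1 th2) lam -> root (ar2_charpoly th1 th2) mu ->
  lam != mu -> th1 = lam + mu /\ th2 = - (lam * mu).
Proof.
rewrite !rootE !hornerE => /eqP r1 /eqP r2 lm.
have e1 : th1 = lam + mu.
  apply: (mulfI (x := lam - mu)); first by rewrite subr_eq0.
  by move: r1 r2; lra.
by split => //; move: r1; rewrite e1; lra.
Qed.

(** * The limit theorem *)

Unset Implicit Arguments.
Set Strict Implicit.

Theorem theorem3p1 (d : measure_display) (T : measurableType d) (R : realType)
  (P : probability T R) (th1 th2 sigma lambda1 lambda2 : R)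
  (Z X : nat -> {RV P >-> R}) (est : nat -> T -> 'cV[R]_2) (N : {RV P >-> R})
  (sigma_gt0 : 0 < sigma)
  (Z_iid : iid Z)
  (Z_law : has_law (Z 0%N) (normal_prob 0 sigma))
  (init_indep : independent_sigma P (g_sigma_preimageU (X 1%N) (X 0%N))
                  (sigma_seq Z))
  (X0_sq : ('E_P[fun w => (X 1%N w ^+ 2)%R] < +oo)%E)
  (Xm1_sq : ('E_P[fun w => (X 0%N w ^+ 2)%R] < +oo)%E)
  (X_ar2 : is_ar2 th1 th2 Z X)
  (Finf_complete : complete_sub P (ar2_sigma_infty X))
  (root1 : root (ar2_charpoly th1 th2) lambda1)
  (root2 : root (ar2_charpoly th1 th2) lambda2)
  (lambda12 : `|lambda2| < `|lambda1|)
  (lambda1_gt1 : 1 < `|lambda1|)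
  (est_lse : forall n, is_lse X n (est n))
  (N_law : has_law N (normal_prob 0 1))
  (N_indep : independent_sigma P (g_sigma_algebra_preimage N)
               (ar2_sigma_infty X)) :
  mixing_cvg P (ar2_sigma_infty X)
    (fun n w => lse_scaling n (X ^~ w) *m (est n w - cv2 th1 th2))
    (fun w => (sigma * N w) *: cv2 1 (Num.sg lambda1)).
Proof.
have lam0 : lambda1 != 0 by rewrite -normr_gt0 (lt_trans _ lambda1_gt1).
have lm : lambda1 != lambda2.
  by apply: contraTneq lambda12 => ->; rewrite ltxx.
have [th1E th2E] := ar2_roots root1 root2 lm.
pose s := Num.sg lambda1.
have [Z_indep Z_same] := Z_iid.
have Z_normal k : follows_law P (Z k) (normal_prob 0 sigma).
  by move=> A mA; rewrite -(Z_law A mA); exact: Z_same.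
have X_rec k w : X k.+2 w =
    (lambda1 + lambda2) * X k.+1 w - lambda1 * lambda2 * X k w + Z k w.
  by rewrite X_ar2 th1E th2E mulNr.
pose z (x : nat -> R) k := x k.+2 - (th1 * x k.+1 + th2 * x k).
have zE w : z (X ^~ w) = Z ^~ w.
  by apply/funext => k; rewrite /z X_ar2; ring.
pose a n w : R := (\sum_(k < n) z (X ^~ w) k * X k.+1 w) /
  Num.sqrt (\sum_(k < n) X k.+1 w ^+ 2).
pose b n w : R := (\sum_(k < n) z (X ^~ w) k * X k w) /
  Num.sqrt (\sum_(k < n) X k w ^+ 2).
have XsE n w : lse_scaling n (X ^~ w) *m (est n w - cv2 th1 th2) = cv2 (a n w) (b n w).
  by apply: scaled_lse_error => th; exact: (est_lse n).2.
have XE w : (sigma * N w) *: cv2 1 s = cv2 (sigma * N w) (s * (sigma * N w)).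
  by apply/colP => j; rewrite !mxE; case: ifP => _; rewrite ?mulr1// mulrC.
pose G := ar2_sigma_infty X.
have sG : sigma_algebra setT G := ar2_sigma_infty_sigma_algebra X.
have GM : G `<=` measurable := @ar2_sigma_infty_measurable _ _ _ _ X.
(* the underlying space with the sigma-algebra of the observed process *)
pose TG := g_sigma_algebraType (\bigcup_n ar2_filtration X n).
have mXG j : measurable_fun setT (X j : TG -> R).
  by apply/measurable_wrtP; exact: ar2_sigma_infty_coord.
have mzG k : measurable_fun setT (fun w : TG => z (X ^~ w) k).
  apply: measurable_funB => //; apply: measurable_funD;
  by apply: measurable_funM => //; exact: measurable_cst.
have maG n : measurable_fun setT (a n : TG -> R).
  exact: (@measurable_self_normalized _ TG R n (fun k => X k.+1)
    (fun k w => z (X ^~ w) k)).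
have mbG n : measurable_fun setT (b n : TG -> R).
  exact: (@measurable_self_normalized _ TG R n (fun k => X k) (fun k w => z (X ^~ w) k)).
have toT (f : T -> R) : measurable_fun setT (f : TG -> R) -> measurable_fun setT f.
  by move=> /measurable_wrtP; exact: measurable_wrt_measurable.
have ma n : measurable_fun setT (a n) := toT _ (maG n).
have mb n : measurable_fun setT (b n) := toT _ (mbG n).
pose U w : R := sigma * N w.
have mN : measurable_fun setT N by exact: measurable_funP.
have mU : measurable_fun setT U by exact: measurable_funM.
have U_normal : follows_law P U (normal_prob 0 sigma).
  have N_std : follows_law P N (normal_prob 0 1).
    by move=> A mA; rewrite -(N_law A mA).
  have := follows_normal_scale (lt0r_neq0 sigma_gt0) ltr01 N_std.
  rewrite mulr1 (gtr0_norm sigma_gt0); exact.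
have UG : independent_sigma P (g_sigma_algebra_preimage U) G.
  apply: sub_independent_sigma N_indep => //.
  move=> _ [B mB <-]; exists ((fun x => sigma * x) @^-1` B) => //.
  rewrite -[X in measurable X]setTI.
  by apply: measurable_funM => //; exact: measurable_cst.
have [rho [e [rho_lam ie mue rhoe rho_e]]] := ar2_rates lambda12 lambda1_gt1.
pose NN n w := block_sum lambda1 (fun k => Z k w) n.
have mNN n : measurable_fun setT (NN n) := measurable_block_sum Z lambda1 n.
pose y := explosive_limit Z X lambda1 lambda2.
have my : measurable_fun setT y := measurable_explosive_limit Z X lambda1 lambda2.
have y_neq0 : {ae P, forall w, y w != 0}.
  exists (y @^-1` [set 0]); split.
  - by rewrite -[X in measurable X]setTI; exact: my.
  - exact: (explosive_limit_neq0 lambda2 sigma_gt0 Z_indep Z_normal init_indep lam0).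
  - by move=> w /= /negP; rewrite negbK => /eqP.
have ab_NN : {ae P, forall w, y w != 0 ->
    (a n w - Num.sg (y w) * NN n w @[n --> \oo] --> 0) /\
    (b n w - Num.sg (y w) * s * NN n w @[n --> \oo] --> 0)}.
  have /andP[rho1 _] := rho_lam.
  apply: filterS (noise_geo_bounded sigma_gt0 Z_normal rho1) => w Zrho.
  have [y' y'_lim ab_y'] := ar2_self_normalized_cvg lambda12 lambda1_gt1 rho_lam
    ie mue rhoe rho_e Zrho (fun k => X_rec k w).
  have yE : y' = y w := explosive_limitP lam0 X_rec y'_lim.
  by rewrite /a /b zE -yE.
have NN_mixing (xi : T -> R) (g : R -> R) : P.-integrable setT (EFin \o xi) ->
    bounded_measurable g -> \int[P]_w (xi w * g (NN n w)) @[n --> \oo] -->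
    (\int[P]_w xi w) * (\int[P]_w g (U w)).
  move=> xi_i g_bm; have [mg [M gM]] := g_bm.
  apply: mixing_cvg_expectation => //.
  - by move=> n m n2 nm; exact: independent_block_sums.
  - move=> n n2; apply: (Rintegral_law (nu := normal_prob 0 sigma)) gM => //.
    exact: follows_normal_block_sum.
have U_sym (g : R -> R) : bounded_measurable g ->
    \int[P]_w g (- U w) = \int[P]_w g (U w).
  move=> [mg [M gM]].
  apply: (Rintegral_law (nu := normal_prob 0 sigma)) gM => //.
    exact: measurable_funN.
  have := @follows_normal_scale _ _ _ P U (-1) sigma; rewrite oppr_eq0 oner_eq0.
  move=> /(_ isT sigma_gt0 U_normal); rewrite normrN1 mul1r.
  by under eq_fun do rewrite mulN1r.
have rv n i : measurable_fun setT (fun w => cv2 (a n w) (b n w) i 0).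
  have -> : (fun w => cv2 (a n w) (b n w) i 0) = if i == 0 then a n else b n.
    by apply/funext => w; rewrite mxE; case: ifP.
  by case: ifP.
split; last first.
  apply: sub_independent_sigma UG => //.
  apply: smallest_sub.
    exact: (@sigma_algebra_measurable _ (g_sigma_algebra_preimageType U)).
  move=> A; rewrite -bigcup_mkord_ord => -[i i2 [B mB <-]].
  pose c := cv2 1 s (inord i) 0 : R.
  exists ((fun x => x * c) @^-1` B).
    rewrite -[X in measurable X]setTI.
    by apply: measurable_funM => //; exact: measurable_cst.
  by apply/seteqP; split=> w /=; rewrite mxE.
split.
- by move=> n i; under eq_fun do rewrite XsE; exact: rv.
- move=> i; under eq_fun do rewrite mxE.
  by apply: measurable_funM => //; exact: measurable_cst.
move=> xi h xi_lty h_cont [M hM].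
have xi_i : P.-integrable setT (EFin \o xi).
  apply/integrableP; split; first by apply/measurable_EFinP; exact: measurable_funP.
  by move: xi_lty; rewrite unlock.
have hXs n : h \o (fun w => lse_scaling n (X ^~ w) *m (est n w - cv2 th1 th2)) =
    (fun w => h (cv2 (a n w) (b n w))).
  by apply/funext => w /=; rewrite XsE.
pose g (x : R) := h (cv2 x (s * x)).
have g_bm : bounded_measurable g.
  split; last by exists M => x; exact: hM.
  by apply: measurable_continuous_cv2 => //; exact: measurable_funM.
have hX : h \o (fun w => (sigma * N w) *: cv2 1 s) = g \o U.
  by apply/funext => w /=; rewrite XE.
have hab_bm n : bounded_measurable (fun w => h (cv2 (a n w) (b n w))).
  split; last by exists M => w; exact: hM.
  exact: measurable_continuous_cv2.
have hab_i n : P.-integrable setT (EFin \o (fun w => h (cv2 (a n w) (b n w)))).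
  exact: bounded_measurable_integrable.
have lhs n : 'E_P[fun w => (xi w * condexp P G
    (h \o (fun w => lse_scaling n (X ^~ w) *m (est n w - cv2 th1 th2))) w)%R]%E =
    (\int[P]_w (xi w * h (cv2 (a n w) (b n w))))%:E.
  rewrite hXs (expectation_mul_condexp _ sG GM (hab_i n)
    (V := fun w => h (cv2 (a n w) (b n w)))).
    rewrite unlock /Rintegral fineK//; apply: integrable_fin_num => //.
    by have [m1 [C b1]] := hab_bm n; exact: integrable_mul_bounded b1.
  apply: is_condexp_self => //.
  by apply/measurable_wrtP; exact: (@measurable_continuous_cv2 _ _ h_cont _ TG).
have rhs : 'E_P[fun w => (xi w * condexp P G
    (h \o (fun w => (sigma * N w) *: cv2 1 s)) w)%R]%E =
    ((\int[P]_w xi w) * \int[P]_w g (U w))%:E.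
  rewrite hX (expectation_mul_condexp _ sG GM _ (is_condexp_cst sG GM mU UG g_bm)).
    rewrite unlock -RintegralZr// /Rintegral fineK//.
    have c_bm := @bounded_measurable_cst _ T R (\int[P]_w g (U w)).
    have [m1 [C b1]] := c_bm.
    by apply: integrable_fin_num => //; exact: integrable_mul_bounded b1.
  by apply: bounded_measurable_integrable; exact: bounded_measurable_comp.
rewrite rhs; under eq_fun do rewrite lhs.
apply/cvg_EFin; first exact: nearW.
exact: (@mixing_transfer _ _ _ _ a b NN y U s ma mb mNN my mU NN_mixing U_sym
  y_neq0 ab_NN h M h_cont hM xi xi_i).
Qed.
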